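(* For all $i,j\in\{1,\dots,\ell\}$ the series $A_i(u),B_i(u),C_i(u),D_i(u)$ with coefficients in the Yangian $Y(\mathfrak g)$ (defined in the context) satisfy the relations $$[A_i(u),A_j(v)]=0,$$ $$[A_i(u),B_j(v)]=[A_i(u),C_j(v)]=0\quad(i\neq j),$$ $$[B_i(u),B_j(v)]=[C_i(u),C_j(v)]=0\quad(a_{ij}=0,\ i\ne j),$$ $$[B_i(u),B_i(v)]=[C_i(u),C_i(v)]=0,\qquad [B_i(u),C_j(v)]=0\quad(i\ne j),$$ $$(u-v)[A_i(u),B_i(v)]=\imath\hbar d_i\big(B_i(u)A_i(v)-B_i(v)A_i(u)\big),$$ $$(u-v)[A_i(u),C_i(v)]=\imath\hbar d_i\big(A_i(u)C_i(v)-A_i(v)C_i(u)\big),$$ $$(u-v)[B_i(u),C_i(v)]=\imath\hbar d_i\big(A_i(u)D_i(v)-A_i(v)D_i(u)\big),$$ $$(u-v)[B_i(u),D_i(v)]=\imath\hbar d_i\big(B_i(u)D_i(v)-B_i(v)D_i(u)\big),$$ $$(u-v)[C_i(u),D_i(v)]=\imath\hbar d_i\big(D_i(u)C_i(v)-D_i(v)C_i(u)\big),$$ $$(u-v)[A_i(u),D_i(v)]=\imath\hbar d_i\big(B_i(u)C_i(v)-B_i(v)C_i(u)\big).$$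
   Context: $\mathfrak g$ is a simple finite-dimensional complex Lie algebra of rank $\ell$ with Cartan subalgebra $\mathfrak h$; $\Gamma=\{1,\dots,\ell\}$ is the set of vertices of the Dynkin diagram, $\alpha_i$ the simple roots, $\alpha_i^\vee$ the coroots, $a_{ij}=\alpha_i^\vee(\alpha_j)$ the Cartan matrix. Positive integers $d_1,\dots,d_\ell$ are such that $\|d_ia_{ij}\|$ is symmetric, and the bilinear form on $\mathfrak h^*$ is $(\alpha_i,\alpha_j)=d_ia_{ij}$; thus $d_i=(\alpha_i,\alpha_i)/2$. $\imath=\sqrt{-1}$, and $\hbar$ is a fixed nonzero complex parameter. Empty products equal $1$. The Yangian $Y(\mathfrak g)$ is the associative unital algebra with generators $H_i^{(s)},E_i^{(s)},F_i^{(s)}$ ($i\in\Gamma$, $s=0,1,\dots$), collected in $$H_i(u)=1+\sum_{s\ge0}H_i^{(s)}u^{-s-1},\quad E_i(u)=\sum_{s\ge0}E_i^{(s)}u^{-s-1},\quad F_i(u)=\sum_{s\ge0}F_i^{(s)}u^{-s-1},$$ and the following defining relations, where $[a,b]_+=ab+ba$: - $[H_i(u),H_j(v)]=0$; - $[H_i(u),E_j(v)]=-\frac{\imath\hbar}{2}(\alpha_i,\alpha_j)\frac{[H_i(u),\,E_j(u)-E_j(v)]_+}{u-v}$ and $[H_i(u),F_j(v)]=\frac{\imath\hbar}{2}(\alpha_i,\alpha_j)\frac{[H_i(u),\,F_j(u)-F_j(v)]_+}{u-v}$; - $[E_i(u),F_j(v)]=-\imath\hbar\,\delta_{i,j}\frac{H_i(u)-H_i(v)}{u-v}$;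 - $[E_i(u),E_i(v)]=-\frac{\imath\hbar}{2}(\alpha_i,\alpha_i)\frac{(E_i(u)-E_i(v))^2}{u-v}$ and $[F_i(u),F_i(v)]=\frac{\imath\hbar}{2}(\alpha_i,\alpha_i)\frac{(F_i(u)-F_i(v))^2}{u-v}$; - for $i\ne j$, $a_{ij}\ne0$: $[E_i(u),E_j(v)]=-\frac{\imath\hbar}{2}(\alpha_i,\alpha_j)\frac{[E_i(u),\,E_j(u)-E_j(v)]_+}{u-v}-\frac{[E_i^{(0)},\,E_j(u)-E_j(v)]}{u-v}$ and $[F_i(u),F_j(v)]=\frac{\imath\hbar}{2}(\alpha_i,\alpha_j)\frac{[F_i(u),\,F_j(u)-F_j(v)]_+}{u-v}-\frac{[F_i^{(0)},\,F_j(u)-F_j(v)]}{u-v}$; - for $i\ne j$, $n=1-a_{ij}$: $\sum_{\sigma\in\mathfrak S_n}[E_i(u_{\sigma(1)}),[E_i(u_{\sigma(2)}),\dots,[E_i(u_{\sigma(n)}),E_j(v)]\dots]]=0$, and the same with $F$ in place of $E$. The series $A_i(u)=1+\sum_{s\ge0}A_i^{(s)}u^{-s-1}$, $i=1,\dots,\ell$, are the formal series, with coefficients in the commutative subalgebra generated by all $H_j^{(s)}$, determined by $$H_i(u)=\frac{\prod_{s\neq i}\prod_{r=1}^{-a_{si}}A_s\big(u-\frac{\imath\hbar}{2}(\alpha_i+r\alpha_s,\alpha_s)\big)}{A_i(u)\,A_i\big(u-\frac{\imath\hbar}{2}(\alpha_i,\alpha_i)\big)},\qquad i=1,\dots,\ell,$$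 where shifted series are re-expanded in powers of $u^{-1}$. Further, $$B_i(u)=d_i^{1/2}A_i(u)E_i(u),\qquad C_i(u)=d_i^{1/2}F_i(u)A_i(u),\qquad D_i(u)=A_i(u)H_i(u)+C_i(u)A_i(u)^{-1}B_i(u).$$ *)

(* Defs.v *)
From HB Require Import structures.
From mathcomp Require Import all_boot all_order all_algebra.
From mathcomp Require Import perm boolp.
From mathcomp Require Import zify.

Set Implicit Arguments.
Unset Strict Implicit.
Unset Printing Implicit Defensive.

Import Order.TTheory GRing.Theory Num.Theory.

Local Open Scope ring_scope.

(** * Simple Lie algebras, Cartan subalgebras, simple roots, coroots *)

Record lie_bracket (K : fieldType) (g : vectType K) := LieBracket {
  lbr :> g -> g -> g;
  lbr_linearl : forall y, linear (lbr^~ y);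
  lbr_linearr : forall x, linear (lbr x);
  lbr_alt : forall x, lbr x x = 0;
  lbr_jacobi : forall x y z,
    lbr x (lbr y z) + lbr y (lbr z x) + lbr z (lbr x y) = 0
}.

Section LieAlgebra.
Variables (K : fieldType) (g : vectType K) (br : lie_bracket g).

Definition lie_ideal (I : {vspace g}) : Prop :=
  forall x y, y \in I -> br x y \in I.

Definition lie_simple : Prop :=
  (exists x y, br x y != 0) /\
  (forall I : {vspace g}, lie_ideal I -> I = 0%VS \/ I = fullv).

Definition ad_diagonalizable (x : g) : Prop :=
  exists e : seq g, basis_of fullv e /\
    (forall y, y \in e -> exists c : K, br x y = c *: y).

Definition toral (h : {vspace g}) : Prop :=
  (forall x y, x \in h -> y \in h -> br x y = 0) /\
  (forall x, x \in h -> ad_diagonalizable x).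

(* In a semisimple complex Lie algebra, the Cartan subalgebras are the maximal
   toral subalgebras. *)
Definition cartan_subalgebra (h : {vspace g}) : Prop :=
  toral h /\ (forall h' : {vspace g}, toral h' -> (h <= h')%VS -> h' = h).

Variable h : {vspace g}.

Definition dual := 'Hom(subvs_of h, K^o).

Definition in_root_space (beta : dual) (x : g) : Prop :=
  forall t : subvs_of h, br (vsval t) x = beta t *: x.

Definition is_root (beta : dual) : Prop :=
  beta != 0 /\ (exists x, x != 0 /\ in_root_space beta x).

Definition simple_roots (l : nat) (alpha : 'I_l -> dual) : Prop :=
  [/\ forall i, is_root (alpha i),
      basis_of fullv [seq alpha i | i : 'I_l]
    & forall beta, is_root beta -> exists c : 'I_l -> nat,
        beta = \sum_i alpha i *+ c i \/ beta = - \sum_i alpha i *+ c i].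

(* [t] is the coroot of [beta]: the middle term of an sl2-triple (e, t, f)
   with e, f in the root spaces of beta and - beta. *)
Definition is_coroot (beta : dual) (t : subvs_of h) : Prop :=
  beta t = 2 /\
  (exists e f, [/\ in_root_space beta e, in_root_space (- beta) f
                 & br e f = vsval t]).

End LieAlgebra.

(** * Formal power series *)

(* [f : fps S] is the series f(u) = \sum_n (f n) u^-n. *)
Definition fps (S : Type) := nat -> S.

HB.instance Definition _ (S : Type) := gen_eqMixin (fps S).
HB.instance Definition _ (S : Type) := gen_choiceMixin (fps S).

Section FpsZmodule.
Variable S : zmodType.
Implicit Types f g : fps S.

Definition fps_zero : fps S := fun=> 0.
Definition fps_opp f : fps S := fun n => - f n.
Definition fps_add f g : fps S := fun n => f n + g n.

Fact fps_addA : associative fps_add.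
Proof. by move=> f g k; apply/funext => n; exact: addrA. Qed.
Fact fps_addC : commutative fps_add.
Proof. by move=> f g; apply/funext => n; exact: addrC. Qed.
Fact fps_add0 : left_id fps_zero fps_add.
Proof. by move=> f; apply/funext => n; exact: add0r. Qed.
Fact fps_addN : left_inverse fps_zero fps_opp fps_add.
Proof. by move=> f; apply/funext => n; exact: addNr. Qed.

HB.instance Definition _ :=
  GRing.isZmodule.Build (fps S) fps_addA fps_addC fps_add0 fps_addN.

End FpsZmodule.

Section FpsRing.
Variable S : nzRingType.
Implicit Types f g : fps S.

Definition fps_const (x : S) : fps S := fun n => if n == 0 then x else 0.
Definition fps_mul f g : fps S := fun n => \sum_(i < n.+1) f i * g (n - i)%N.

Fact fps_mul_poly N f g n : (n < N)%N ->
  fps_mul f g n = ((\poly_(i < N) f i) * (\poly_(i < N) g i))`_n.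
Proof.
move=> ltnN; rewrite coefM; apply: eq_bigr => i _; rewrite !coef_poly.
have le_in : (i <= n)%N by rewrite -ltnS.
by rewrite (leq_ltn_trans le_in ltnN) (leq_ltn_trans (leq_subr i n) ltnN).
Qed.

Fact fps_mulA : associative fps_mul.
Proof.
move=> f g k; apply/funext => n.
pose p (x : fps S) := \poly_(i < n.+1) x i.
have coef_p x i : (i <= n)%N -> (p x)`_i = x i.
  by rewrite coef_poly -ltnS => ->.
transitivity ((p f * (p g * p k))`_n).
  rewrite coefM; apply: eq_bigr => i _.
  have le_in : (i <= n)%N by rewrite -ltnS.
  by rewrite coef_p // (@fps_mul_poly n.+1) // ltnS leq_subr.
rewrite mulrA coefM; apply: eq_bigr => i _.
by rewrite coef_p ?leq_subr // (@fps_mul_poly n.+1).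
Qed.

Fact fps_mul1 : left_id (fps_const 1) fps_mul.
Proof.
move=> f; apply/funext => n; rewrite /fps_mul big_ord_recl /= mul1r subn0.
by rewrite big1 ?addr0 // => i _; rewrite mul0r.
Qed.

Fact fps_mulr1 : right_id (fps_const 1) fps_mul.
Proof.
move=> f; apply/funext => n; rewrite /fps_mul big_ord_recr /= subnn mulr1.
rewrite big1 ?add0r // => i _.
by rewrite /fps_const subn_eq0 leqNgt ltn_ord mulr0.
Qed.

Fact fps_mulDl : left_distributive fps_mul (@GRing.add (fps S)).
Proof.
move=> f g k; apply/funext => n.
by rewrite -[RHS]big_split; apply: eq_bigr => i _; exact: mulrDl.
Qed.

Fact fps_mulDr : right_distributive fps_mul (@GRing.add (fps S)).
Proof.
move=> f g k; apply/funext => n.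
by rewrite -[RHS]big_split; apply: eq_bigr => i _; exact: mulrDr.
Qed.

Fact fps_oner_neq0 : fps_const 1 != 0 :> fps S.
Proof.
by apply/eqP => /(congr1 (fun f : fps S => f 0)) /eqP; rewrite (negPf (oner_neq0 S)).
Qed.

HB.instance Definition _ := GRing.Zmodule_isNzRing.Build (fps S)
  fps_mulA fps_mul1 fps_mulr1 fps_mulDl fps_mulDr fps_oner_neq0.

(* The series u^-1. *)
Definition fps_uinv : fps S := fun n => (n == 1)%:R.

(* Inverse of a series with constant term 1, i.e. \sum_k (1 - f)^k, where only
   the terms k <= n contribute to the coefficient of u^-n. *)
Definition fps_inv f : fps S := fun n => \sum_(k < n.+1) ((1 - f) ^+ k) n.

Lemma fps_coefM f g n : (f * g) n = \sum_(i < n.+1) f i * g (n - i)%N.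
Proof. by []. Qed.

Lemma fps_coef_sum (I : Type) (r : seq I) (P : pred I) (f : I -> fps S) n :
  (\sum_(i <- r | P i) f i) n = \sum_(i <- r | P i) f i n.
Proof. exact: (big_morph (fun f : fps S => f n)). Qed.

Lemma fps_coef_exp_small f (k n : nat) : f 0 = 0 -> (n < k)%N -> (f ^+ k) n = 0.
Proof.
move=> f0; elim: k n => // k IHk n ltnk.
rewrite exprS fps_coefM big1 // => -[[|i] /= lt_in] _; first by rewrite f0 mul0r.
by rewrite IHk ?mulr0 //; lia.
Qed.

Lemma fps_inv_trunc f (n N : nat) : f 0 = 1 -> (n < N)%N ->
  fps_inv f n = (\sum_(k < N) (1 - f) ^+ k) n.
Proof.
move=> f0 ltnN; rewrite fps_coef_sum /fps_inv.
rewrite (big_ord_widen N (fun k => ((1 - f) ^+ k) n)) // big_mkcond.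
apply: eq_bigr => k _; case: ifP => // /negbT; rewrite -leqNgt => lt_nk.
by rewrite fps_coef_exp_small // -[LHS]/(1 - f 0) f0 subrr.
Qed.

Lemma fps_mulrV f : f 0 = 1 -> f * fps_inv f = 1.
Proof.
move=> f0; apply/funext => n.
transitivity ((f * \sum_(k < n.+1) (1 - f) ^+ k) n).
  rewrite !fps_coefM; apply: eq_bigr => i _.
  by rewrite (@fps_inv_trunc _ _ n.+1) // ltnS leq_subr.
rewrite -[f in f * _](subKr 1) -opprB mulNr -subrX1 opprB.
rewrite -[LHS]/((1 : fps S) n - ((1 - f) ^+ n.+1) n).
by rewrite fps_coef_exp_small ?subr0 // -[LHS]/(1 - f 0) f0 subrr.
Qed.

Lemma fps_mulVr f : f 0 = 1 -> fps_inv f * f = 1.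
Proof.
move=> f0; apply/funext => n.
transitivity (((\sum_(k < n.+1) (1 - f) ^+ k) * f) n).
  rewrite !fps_coefM; apply: eq_bigr => -[i /= lt_in] _.
  by rewrite (@fps_inv_trunc _ _ n.+1).
rewrite mulr_suml.
under eq_bigr do rewrite -[f in _ * f](subKr 1) mulrBr mulr1 -exprSr.
rewrite -(big_mkord xpredT (fun k => (1 - f) ^+ k - (1 - f) ^+ k.+1)).
under eq_bigr do rewrite -opprB; rewrite sumrN telescope_sumr // opprB expr0.
rewrite -[LHS]/((1 : fps S) n - ((1 - f) ^+ n.+1) n).
by rewrite fps_coef_exp_small ?subr0 // -[LHS]/(1 - f 0) f0 subrr.
Qed.

End FpsRing.

Section FpsLmodule.
Variables (K : nzRingType) (V : lmodType K).
Implicit Types f g : fps V.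

Definition fps_scale (c : K) f : fps V := fun n => c *: f n.

Fact fps_scaleA c1 c2 f :
  fps_scale c1 (fps_scale c2 f) = fps_scale (c1 * c2) f.
Proof. by apply/funext => n; exact: scalerA. Qed.
Fact fps_scale1 : left_id 1 fps_scale.
Proof. by move=> f; apply/funext => n; exact: scale1r. Qed.
Fact fps_scaleDr : right_distributive fps_scale +%R.
Proof. by move=> c f g; apply/funext => n; exact: scalerDr. Qed.
Fact fps_scaleDl f : {morph fps_scale^~ f : c1 c2 / c1 + c2}.
Proof. by move=> c1 c2; apply/funext => n; exact: scalerDl. Qed.

HB.instance Definition _ := GRing.Zmodule_isLmodule.Build K (fps V)
  fps_scaleA fps_scale1 fps_scaleDr fps_scaleDl.

End FpsLmodule.

Section FpsAlgebra.
Variables (K : nzRingType) (S : algType K).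
Implicit Types f g : fps S.

Fact fps_scaleAl (c : K) f g : c *: (f * g) = (c *: f) * g.
Proof.
apply/funext => n; rewrite -[LHS]/(c *: \sum_(i < n.+1) f i * g (n - i)%N).
by rewrite scaler_sumr; apply: eq_bigr => i _; exact: scalerAl.
Qed.

HB.instance Definition _ :=
  GRing.Lmodule_isLalgebra.Build K (fps S) fps_scaleAl.

Fact fps_scaleAr (c : K) f g : c *: (f * g) = f * (c *: g).
Proof.
apply/funext => n; rewrite -[LHS]/(c *: \sum_(i < n.+1) f i * g (n - i)%N).
by rewrite scaler_sumr; apply: eq_bigr => i _; exact: scalerAr.
Qed.

HB.instance Definition _ :=
  GRing.Lalgebra_isAlgebra.Build K (fps S) fps_scaleAr.

(* f(u - c), re-expanded in powers of u^-1:
   (u - c)^-1 = u^-1 (1 - c u^-1)^-1. *)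
Definition fps_shift (c : K) f : fps S := fun n =>
  \sum_(m < n.+1)
    f m * ((fps_uinv S * fps_inv (1 - c *: fps_uinv S)) ^+ m) n.

End FpsAlgebra.

Section TwoVariables.
Variable S : nzRingType.
Implicit Type f : fps S.

(* An element Z of fps (fps S) is a series in u and v: Z m n is the coefficient
   of u^-m v^-n. *)
Definition in_u f : fps (fps S) := fun m => fps_const (f m).
Definition in_v f : fps (fps S) := fps_const f.

(* (u - v) Z = W, i.e. Z = W / (u - v), multiplied by u^-1 v^-1 to remain within
   series in u^-1 and v^-1. *)
Definition umv_mul_eq (Z W : fps (fps S)) : Prop :=
  (in_v (fps_uinv S) - in_u (fps_uinv S)) * Z =
  in_u (fps_uinv S) * in_v (fps_uinv S) * W.

End TwoVariables.

Definition lcomm (S : nzRingType) (x y : S) : S := x * y - y * x.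
Definition acomm (S : nzRingType) (x y : S) : S := x * y + y * x.

(* gen0 X = \sum_s (X s) u^-(s + 1) and gen1 X = 1 + gen0 X. *)
Definition gen0 (S : nzRingType) (X : nat -> S) : fps S :=
  fun n => if n is s.+1 then X s else 0.
Definition gen1 (S : nzRingType) (X : nat -> S) : fps S := 1 + gen0 X.

(** * The Yangian *)

Section Yangian.
Variables (K : numClosedFieldType) (l : nat).
Variables (a : 'M[int]_l) (d : 'I_l -> nat) (hbar : K).

(* (alpha_i, alpha_j) *)
Definition rform (i j : 'I_l) : int := (d i)%:Z * a i j.

Definition kap (i j : 'I_l) : K := 'i * hbar / 2 * (rform i j)%:~R.

(* The coefficient of u_1^-(s_1 + 1) ... u_n^-(s_n + 1) v^-(t + 1) in
   \sum_sigma [X(u_sigma(1)), [X(u_sigma(2)), ... [X(u_sigma(n)), Z(v)] ... ]],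
   where n = 1 - a_ij and z is the coefficient of v^-(t + 1) in Z(v). *)
Definition serre_coef (S : nzRingType) (X : nat -> S) (z : S) (n : nat)
    (s : 'I_n -> nat) : S :=
  \sum_(sigma : 'S_n) foldr (fun k => lcomm (X (s (sigma k)))) z (enum 'I_n).

Record yangian_rel (Y : algType K) (H E F : 'I_l -> nat -> Y) : Prop := {
  yHH : forall i j, let Hi := gen1 (H i) in let Hj := gen1 (H j) in
    lcomm (in_u Hi) (in_v Hj) = 0;
  yHE : forall i j, let Hi := gen1 (H i) in let Ej := gen0 (E j) in
    umv_mul_eq (lcomm (in_u Hi) (in_v Ej))
      (- kap i j *: acomm (in_u Hi) (in_u Ej - in_v Ej));
  yHF : forall i j, let Hi := gen1 (H i) in let Fj := gen0 (F j) in
    umv_mul_eq (lcomm (in_u Hi) (in_v Fj))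
      (kap i j *: acomm (in_u Hi) (in_u Fj - in_v Fj));
  yEF : forall i j,
    let Ei := gen0 (E i) in let Fj := gen0 (F j) in let Hi := gen1 (H i) in
    umv_mul_eq (lcomm (in_u Ei) (in_v Fj))
      (- ('i * hbar * (i == j)%:R) *: (in_u Hi - in_v Hi));
  yEE : forall i, let Ei := gen0 (E i) in
    umv_mul_eq (lcomm (in_u Ei) (in_v Ei))
      (- kap i i *: (in_u Ei - in_v Ei) ^+ 2);
  yFF : forall i, let Fi := gen0 (F i) in
    umv_mul_eq (lcomm (in_u Fi) (in_v Fi))
      (kap i i *: (in_u Fi - in_v Fi) ^+ 2);
  yEE' : forall i j, i != j -> a i j != 0 ->
    let Ei := gen0 (E i) in let Ej := gen0 (E j) in
    umv_mul_eq (lcomm (in_u Ei) (in_v Ej))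
      (- kap i j *: acomm (in_u Ei) (in_u Ej - in_v Ej)
       - lcomm (in_u (fps_const (E i 0))) (in_u Ej - in_v Ej));
  yFF' : forall i j, i != j -> a i j != 0 ->
    let Fi := gen0 (F i) in let Fj := gen0 (F j) in
    umv_mul_eq (lcomm (in_u Fi) (in_v Fj))
      (kap i j *: acomm (in_u Fi) (in_u Fj - in_v Fj)
       - lcomm (in_u (fps_const (F i 0))) (in_u Fj - in_v Fj));
  ySerreE : forall i j, i != j -> forall (s : 'I_(absz (1 - a i j)) -> nat) t,
    serre_coef (E i) (E j t) s = 0;
  ySerreF : forall i j, i != j -> forall (s : 'I_(absz (1 - a i j)) -> nat) t,
    serre_coef (F i) (F j t) s = 0
}.

(* [Y] is the unital associative algebra presented by the generators H, E, F
   and the relations [yangian_rel]. *)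
Definition is_yangian (Y : algType K) (H E F : 'I_l -> nat -> Y) : Prop :=
  yangian_rel H E F /\
  (forall (Y' : algType K) (H' E' F' : 'I_l -> nat -> Y'),
    yangian_rel H' E' F' ->
    exists phi : {lrmorphism Y -> Y'},
      (forall i s, [/\ phi (H i s) = H' i s, phi (E i s) = E' i s
                     & phi (F i s) = F' i s]) /\
      (forall psi : {lrmorphism Y -> Y'},
        (forall i s, [/\ psi (H i s) = H' i s, psi (E i s) = E' i s
                       & psi (F i s) = F' i s]) -> psi =1 phi)).

Section Series.
Variables (Y : algType K) (H E F A : 'I_l -> nat -> Y).

Definition coefs_in_H_subalgebra : Prop :=
  forall S : {pred Y}, subalg_closed S -> (forall j s, H j s \in S) ->
  forall i s, A i s \in S.

(* The factorisation of the H_i(u) which determines the A_i(u). For s != i the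
   integer - a_si is nonnegative, hence equal to its absolute value. *)
Definition H_factorisation : Prop := forall i,
  gen1 (H i) =
    (\prod_(s < l | s != i) \prod_(1 <= r < (absz (- a s i)).+1)
       fps_shift ('i * hbar / 2 * (rform i s + r%:Z * rform s s)%:~R)
         (gen1 (A s)))
    * fps_inv (gen1 (A i) * fps_shift (kap i i) (gen1 (A i))).

Definition Aser i : fps Y := gen1 (A i).
Definition Bser i : fps Y := sqrtC (d i)%:R *: (Aser i * gen0 (E i)).
Definition Cser i : fps Y := sqrtC (d i)%:R *: (gen0 (F i) * Aser i).
Definition Dser i : fps Y :=
  Aser i * gen1 (H i) + Cser i * fps_inv (Aser i) * Bser i.

End Series.

End Yangian.

(* Main.v *)
From Stdlib Require Import Ncring Ncring_tac.
Require Import Defs.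
From HB Require Import structures.
From mathcomp Require Import all_boot all_order all_algebra.
From mathcomp Require Import perm boolp zify ring.
From mathcomp Require Import reals complex.

(* Conjugation by H_i(u) multiplies the current E_j by a rational function of
   u - w, where w shifts the modes E_j^(r) to E_j^(r+1). Comparing lowest-order
   terms in the factorisation of the H_i, and using that the Cartan matrix is
   invertible, the same is true of the A_i: A_i(u) commutes with E_j for i <> j,
   while A_j(u) (u - w + c) E_j = (u - w) E_j A_j(u) with c = i hbar d_j. In
   generating series,
     (u - v) [A_j(u), E_j(v)] = c A_j(u) (E_j(u) - E_j(v)),
   and similarly for F_j. The relations between A, B, C, D then follow by
   computing in the ring of series in u^-1 and v^-1, where u - v can be
   cancelled; the relations involving C come from those involving B by passing
   to the opposite ring, which exchanges E and F.

   The Cartan matrix is invertible because the coroots are linearly independent: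
   for the Killing form, (t_s, t) is a multiple of alpha_s(t) by a nonzero
   constant, as 2 (t_s, t_s) is a sum of squares of real eigenvalues. *)

Set Implicit Arguments.
Unset Strict Implicit.
Unset Printing Implicit Defensive.

Import Order.TTheory GRing.Theory Num.Theory.

Local Open Scope ring_scope.

(** * Relations in a noncommutative ring *)

(** The factorisation constrains only products of shifted [A_s(u)], so the behaviour of a single
    [A_s(u)] cannot be read off from it. This forces an induction on the order [n] in [u^-1]: if the
    expected relations hold below order [n], the errors of order [n] add up under products, because
    all series involved have constant term 1, and these errors are not changed by shifts of [u]. The
    two sides of the factorisation agree in their parameters because [A_j(u - e)] replaces
    [u - w + c - e] by [u - w - e]: the factors coming from [A_j] telescope, and
    [d_i a_ij = d_j a_ji] makes the total effect that of [H_i(u)]. Only a linear system for the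
    errors remains. In two variables [u - v] can be cancelled but not inverted. Quotients such as
    [(f(u) - f(v)) / (u - v)] are nevertheless series; with them as extra letters every exchange
    relation becomes free of denominators, and both sides of a relation can be compared after normal
    ordering. *)

Section NoncommutativeRing.
Variable S : pzRingType.

#[global] Instance pzRing_ops : @Ring_ops S 0 1 (@GRing.add S) (@GRing.mul S)
  (fun x y => x - y) (@GRing.opp S) (@eq S) := {}.

#[global] Instance pzRing_Ring : @Ring _ _ _ _ _ _ _ _ pzRing_ops.
Proof.
by split; rewrite /zero /one /addition /multiplication /subtraction /opposite
  /add_notation /mul_notation /sub_notation /opp_notation /eq_notation
  /zero_notation /one_notation /equality; try exact _; move=> *;
  rewrite ?add0r ?mul1r ?mulr1 ?mulrA ?mulrDl ?mulrDr ?addrA ?subrr // addrC.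
Qed.

End NoncommutativeRing.

Ltac ncring := non_commutative_ring.

(* With t = u - v = dl / (u^-1 v^-1): a, b = A(u), A(v); h, h' = H(u), H(v);
   e, e' and f, f' likewise; eps, phi and eta are the divided differences
   (e - e') / t, (f - f') / t and (h' - h) / t up to constants. *)
Record current_relations (S : nzRingType)
    (dl kp pi d a b h h' e e' f f' eps phi eta : S) : Prop := {
  dlC : forall x, x * dl = dl * x;
  kpC : forall x, x * kp = kp * x;
  piC : forall x, x * pi = pi * x;
  dC : forall x, x * d = d * x;
  dlI : forall x, dl * x = 0 -> x = 0;
  kpE : kp = d * pi;
  epsE : dl * eps = kp * (e - e');
  phiE : dl * phi = kp * (f - f');
  etaE : dl * eta = pi * (h' - h);
  abC : a * b = b * a;
  ahC : a * h = h * a;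
  ah'C : a * h' = h' * a;
  bhC : b * h = h * b;
  bh'C : b * h' = h' * b;
  ae'_comm : dl * (a * e' - e' * a) = kp * (a * (e - e'));
  be_comm : dl * (b * e - e * b) = kp * (b * (e - e'));
  f'a_comm : dl * (f' * a - a * f') = kp * ((f - f') * a);
  fb_comm : dl * (f * b - b * f) = kp * ((f - f') * b);
  ee'_comm : dl * (e * e' - e' * e) = - kp * ((e - e') * (e - e'));
  ff'_comm : dl * (f * f' - f' * f) = kp * ((f - f') * (f - f'));
  ef'_comm : dl * (e * f' - f' * e) = pi * (h' - h);
  e'f_comm : dl * (e' * f - f * e') = pi * (h' - h);
  h'e_comm : dl * (h' * e - e * h') = - kp * (h' * (e - e') + (e - e') * h');
  he'_comm : dl * (h * e' - e' * h) = - kp * (h * (e - e') + (e - e') * h);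
  h'f_comm : dl * (h' * f - f * h') = kp * (h' * (f - f') + (f - f') * h');
  hf'_comm : dl * (h * f' - f' * h) = kp * (h * (f - f') + (f - f') * h)
}.

(** Reversing products negates commutators, which compensates the opposite signs in the relations
    for [e] and for [f]; the relations [ef'_comm] and [e'f_comm] trade places. *)
Lemma current_relations_rev (S : nzRingType)
    (dl kp pi d a b h h' e e' f f' eps phi eta : S) :
  current_relations dl kp pi d a b h h' e e' f f' eps phi eta ->
  @current_relations S^c dl kp pi d a b h h' f f' e e' phi eps eta.
Proof.
case=> dlC kpC piC dC dlI kpE epsE phiE etaE abC ahC ah'C bhC bh'C.
move=> ae'C beC f'aC fbC ee'C ff'C ef'C e'fC h'eC he'C h'fC hf'C.
(* A product in [S^c] is convertible to the reversed product in [S], so each field asks for a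
   relation of [S] with its central factor on the right. *)
have rev (z x y : S) : (forall x, x * z = z * x) ->
  dl * x = z * y -> x * dl = y * z by move=> zC; rewrite dlC zC.
have kpNC x : x * - kp = - kp * x by rewrite mulrN kpC mulNr.
split.
- by move=> x; exact: esym (dlC x).
- by move=> x; exact: esym (kpC x).
- by move=> x; exact: esym (piC x).
- by move=> x; exact: esym (dC x).
- by move=> x /(etrans (esym (dlC x))); exact: dlI.
- by rewrite kpE; exact: esym (dC _).
- exact: rev.
- exact: rev.
- exact: rev.
- exact: esym abC.
- exact: esym ahC.
- exact: esym ah'C.
- exact: esym bhC.
- exact: esym bh'C.
- exact: rev.
- exact: rev.
- exact: rev.
- exact: rev.
- apply: (rev (- kp) (f' * f - f * f')) => //.
  by rewrite mulNr -ff'C -[RHS]mulrN opprB.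
- apply: (rev kp (e' * e - e * e')) => //.
  by rewrite -(opprB (e * e')) mulrN ee'C mulNr opprK.
- exact: rev.
- exact: rev.
- apply: (rev (- kp) (f * h' - h' * f) ((f - f') * h' + h' * (f - f'))) => //.
  by rewrite mulNr [(f - f') * h' + _]addrC -h'fC -[RHS]mulrN opprB.
- apply: (rev (- kp) (f' * h - h * f') ((f - f') * h + h * (f - f'))) => //.
  by rewrite mulNr [(f - f') * h + _]addrC -hf'C -[RHS]mulrN opprB.
- apply: (rev kp (e * h' - h' * e) ((e - e') * h' + h' * (e - e'))) => //.
  by rewrite -(opprB (h' * e)) mulrN h'eC mulNr opprK addrC.
- apply: (rev kp (e' * h - h * e') ((e - e') * h + h * (e - e'))) => //.
  by rewrite -(opprB (h * e')) mulrN he'C mulNr opprK addrC.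
Qed.

Section Relations.
Variables (S : nzRingType) (dl kp pi d a b h h' e e' f f' eps phi eta : S).
Hypothesis rel : current_relations dl kp pi d a b h h' e e' f f' eps phi eta.

Lemma dl_inj x y : dl * x = dl * y -> x = y.
Proof.
by move=> dlxy; apply/subr0_eq/(dlI rel); rewrite mulrBr dlxy subrr.
Qed.

Lemma mul_eps x y : dl * (x * eps * y) = kp * (x * (e - e') * y).
Proof.
by rewrite !mulrA -(dlC rel) -(kpC rel) -!(mulrA x) (epsE rel).
Qed.

Lemma mul_phi x y : dl * (x * phi * y) = kp * (x * (f - f') * y).
Proof.
by rewrite !mulrA -(dlC rel) -(kpC rel) -!(mulrA x) (phiE rel).
Qed.

Lemma mul_eta x y : dl * (x * (d * eta) * y) = kp * (x * (h' - h) * y).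
Proof.
rewrite !mulrA -(dlC rel) -(kpC rel) -!mulrA; congr (x * _).
by rewrite !mulrA -(dlC rel d) -!mulrA (mulrA dl) (etaE rel) (kpE rel) !mulrA.
Qed.

(* Multiplied by dl, both sides become kp (f - f') y (e - e') up to x and z. *)
Lemma swap_phi_eps x y z :
  x * phi * y * (e - e') * z = x * (f - f') * y * eps * z.
Proof.
apply: dl_inj; rewrite (mul_eps (x * (f - f') * y)).
by rewrite -(mulrA (x * phi)) -(mulrA (x * phi)) mul_phi !mulrA.
Qed.

Lemma swap_eta_eps x y z :
  x * (d * eta) * y * (e - e') * z = x * (h' - h) * y * eps * z.
Proof.
apply: dl_inj; rewrite (mul_eps (x * (h' - h) * y)).
by rewrite -(mulrA (x * _)) -(mulrA (x * _)) mul_eta !mulrA.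
Qed.

(** From here on each relation is an element equal to 0, with [dl] cancelled by means of [eps],
    [phi] or [eta]. An identity then follows by writing the difference of its sides as an explicit
    combination of such elements, checked by [ncring], and rewriting them to 0. *)
Lemma ae'_eps : a * e' - e' * a - a * eps = 0.
Proof.
apply/eqP; rewrite subr_eq0; apply/eqP/dl_inj; rewrite (ae'_comm rel).
by have := mul_eps a 1; rewrite !mulr1.
Qed.

Lemma be_eps : b * e - e * b - b * eps = 0.
Proof.
apply/eqP; rewrite subr_eq0; apply/eqP/dl_inj; rewrite (be_comm rel).
by have := mul_eps b 1; rewrite !mulr1.
Qed.

Lemma f'a_phi : f' * a - a * f' - phi * a = 0.
Proof.
apply/eqP; rewrite subr_eq0; apply/eqP/dl_inj; rewrite (f'a_comm rel).
by have := mul_phi 1 a; rewrite !mul1r.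
Qed.

Lemma fb_phi : f * b - b * f - phi * b = 0.
Proof.
apply/eqP; rewrite subr_eq0; apply/eqP/dl_inj; rewrite (fb_comm rel).
by have := mul_phi 1 b; rewrite !mul1r.
Qed.

Lemma ee'_eps : e * e' - e' * e + eps * (e - e') = 0.
Proof.
apply/eqP; rewrite addr_eq0; apply/eqP/dl_inj; rewrite (ee'_comm rel).
by have := mul_eps 1 (e - e'); rewrite !mul1r mulNr mulrN => ->.
Qed.

Lemma ef'_eta : e * f' - f' * e - eta = 0.
Proof.
apply/eqP; rewrite subr_eq0; apply/eqP/dl_inj.
by rewrite (ef'_comm rel) (etaE rel).
Qed.

Lemma e'f_eta : e' * f - f * e' - eta = 0.
Proof.
apply/eqP; rewrite subr_eq0; apply/eqP/dl_inj.
by rewrite (e'f_comm rel) (etaE rel).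
Qed.

Lemma h'e_eps : h' * e - e * h' + h' * eps + eps * h' = 0.
Proof.
apply/eqP; rewrite -addrA addr_eq0; apply/eqP/dl_inj; rewrite (h'e_comm rel).
have := mul_eps h' 1; have := mul_eps 1 h'; rewrite !mul1r !mulr1 => E1 E2.
by rewrite mulNr [RHS]mulrN (mulrDr kp) (mulrDr dl) E1 E2.
Qed.

Lemma he'_eps : h * e' - e' * h + h * eps + eps * h = 0.
Proof.
apply/eqP; rewrite -addrA addr_eq0; apply/eqP/dl_inj; rewrite (he'_comm rel).
have := mul_eps h 1; have := mul_eps 1 h; rewrite !mul1r !mulr1 => E1 E2.
by rewrite mulNr [RHS]mulrN (mulrDr kp) (mulrDr dl) E1 E2.
Qed.

Lemma a_eta : a * eta - eta * a = 0.
Proof.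
apply/eqP; rewrite subr_eq0; apply/eqP/dl_inj.
rewrite [RHS]mulrA (etaE rel) mulrA -(dlC rel a) -mulrA (etaE rel).
by rewrite mulrA (piC rel) -!mulrA mulrBr mulrBl (ahC rel) (ah'C rel).
Qed.

Lemma b_eta : b * eta - eta * b = 0.
Proof.
apply/eqP; rewrite subr_eq0; apply/eqP/dl_inj.
rewrite [RHS]mulrA (etaE rel) mulrA -(dlC rel b) -mulrA (etaE rel).
by rewrite mulrA (piC rel) -!mulrA mulrBr mulrBl (bhC rel) (bh'C rel).
Qed.

Lemma ab_comm : a * b - b * a = 0. Proof. by rewrite (abC rel) subrr. Qed.
Lemma ah'_comm : a * h' - h' * a = 0. Proof. by rewrite (ah'C rel) subrr. Qed.
Lemma bh_comm : b * h - h * b = 0. Proof. by rewrite (bhC rel) subrr. Qed.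
Lemma bh'_comm : b * h' - h' * b = 0. Proof. by rewrite (bh'C rel) subrr. Qed.
Lemma d_comm x : x * d - d * x = 0. Proof. by rewrite (dC rel) subrr. Qed.

Local Definition zeros := (a_eta, b_eta, ab_comm, ah'_comm, bh_comm, bh'_comm,
  ae'_eps, be_eps, f'a_phi, fb_phi, ee'_eps, ef'_eta, e'f_eta, h'e_eps, he'_eps,
  d_comm, mulr0, mul0r, addr0, add0r, subr0, oppr0).

Lemma AB_relation :
  dl * (a * (b * e') - b * e' * a) = kp * (a * e * b - b * e' * a).
Proof.
have -> : a * (b * e') - b * e' * a = a * b * eps.
  apply/subr0_eq; rewrite (_ : _ - _ = (a * b - b * a) * e'
    + b * (a * e' - e' * a - a * eps) - (a * b - b * a) * eps); last by ncring.
  by rewrite !zeros.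
have -> : a * e * b - b * e' * a = a * b * (e - e').
  apply/subr0_eq; rewrite (_ : _ - _ = (a * b - b * a) * e'
    - a * (b * e - e * b - b * eps) + b * (a * e' - e' * a - a * eps)
     - (a * b - b * a) * eps); last by ncring.
  by rewrite !zeros.
by have := mul_eps (a * b) 1; rewrite !mulr1.
Qed.

Lemma BB_relation : a * e * (b * e') - b * e' * (a * e) = 0.
Proof.
rewrite (_ : _ - _ = a * b * (e * e' - e' * e + eps * (e - e'))
  + (a * b - b * a) * (e' * e - eps * e)
  - a * (b * e - e * b - b * eps) * e'
  + b * (a * e' - e' * a - a * eps) * e); last by ncring.
by rewrite !zeros.
Qed.

(** Normal order puts [f], [f'], [phi] first, then [a], [b], then [e], [e'], [eps]. The term with
    [eta] arises when [e] passes [f']. *)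
Lemma aef'b_normal : a * e * (f' * b) =
  f' * a * b * e - f' * a * b * eps - phi * a * b * e + phi * a * b * eps
  + a * eta * b.
Proof.
apply/subr0_eq; rewrite (_ : _ - _ = (phi * a - f' * a) *
    (b * e - e * b - b * eps)
  - (f' * a - a * f' - phi * a) * e * b + a * (e * f' - f' * e - eta) * b);
  last by ncring.
by rewrite !zeros.
Qed.

Lemma be'fa_normal : b * e' * (f * a) =
  f * a * b * e' - f * a * b * eps - phi * a * b * e' + phi * a * b * eps
  + a * eta * b.
Proof.
apply/subr0_eq; rewrite (_ : _ - _ = (phi * b - f * b) *
    (a * e' - e' * a - a * eps)
  - (f * b - b * f - phi * b) * e' * a + b * (e' * f - f * e' - eta) * a
  + (phi - f) * (a * b - b * a) * (e' - eps)
  + a * (b * eta - eta * b) - b * (a * eta - eta * a)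
  - (a * b - b * a) * eta); last by ncring.
by rewrite !zeros.
Qed.

(** [A H + C A^-1 B] with [A^-1] cancelled; [d] is the product of the two factors [d^(1/2)] of [B]
    and [C]. *)
Local Notation Du := (a * h + d * (f * a * e)).
Local Notation Dv := (b * h' + d * (f' * b * e')).

Lemma AD_relation :
  dl * (a * Dv - Dv * a) = kp * (d * (a * e * (f' * b) - b * e' * (f * a))).
Proof.
have -> : a * Dv - Dv * a = d * f' * a * b * eps * 1 - d * phi * (a * b * e').
  apply/subr0_eq; rewrite (_ : _ - _ = (a * b - b * a) * h'
   + b * (a * h' - h' * a) + (a * d - d * a) * f' * b * e'
   + d * (f' * (a * b - b * a) * e' - (f' * a - a * f' - phi * a) * b * e'
          + f' * b * (a * e' - e' * a - a * eps) - f' * (a * b - b * a) * eps));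
   last by ncring.
  by rewrite !zeros.
rewrite mulrBr mul_eps mul_phi -mulrBr aef'b_normal be'fa_normal; congr (kp * _).
(* The normal forms leave a [phi] next to [e - e'] on one side and an [eps] next to [f - f'] on the
   other; these terms agree. *)
have E := swap_phi_eps d (a * b) 1.
apply/subr0_eq; rewrite (_ : _ - _ = d * phi * (a * b) * (e - e') * 1
  - d * (f - f') * (a * b) * eps * 1); last by ncring.
by rewrite E subrr.
Qed.

Lemma BC_relation :
  dl * (d * (a * e * (f' * b) - f' * b * (a * e))) = kp * (a * Dv - b * Du).
Proof.
have -> : d * (a * e * (f' * b) - f' * b * (a * e)) =
  a * (d * eta) * b - d * f' * a * b * eps * 1 - d * phi * (a * b * e)
  + d * phi * a * b * eps * 1.
  rewrite aef'b_normal; apply/subr0_eq.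
  rewrite (_ : _ - _ = d * f' * (a * b - b * a) * e
    - (a * d - d * a) * eta * b); last by ncring.
  by rewrite !zeros.
(* The [eta] term turns into [a * (h' - h) * b], which accounts for the [A H] parts of [Dv] and
   [Du]; the other terms give the [F A E] parts. *)
rewrite mulrDr 2!mulrBr !mul_eps mul_phi mul_eta -!mulrBr -mulrDr.
congr (kp * _); apply/subr0_eq.
rewrite (_ : _ - _ = - (a * (b * h' - h' * b) - a * (b * h - h * b)
  + (a * b - b * a) * h + (a * d - d * a) * f' * b * e'
  - d * (f' * a - a * f' - phi * a) * b * e' - (b * d - d * b) * f * a * e
  + d * (f * b - b * f - phi * b) * a * e
  + d * (f - phi) * (a * b - b * a) * e)); last by ncring.
by rewrite !zeros.
Qed.

Lemma BD_relation :
  dl * (a * e * Dv - Dv * (a * e)) = kp * (a * e * Dv - b * e' * Du).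
Proof.
have -> : a * e * Dv - Dv * (a * e) = a * b * h' * eps * 1
    - d * phi * (a * b * e * e') + d * phi * a * b * eps * e'
    + a * (d * eta) * (b * e').
  rewrite (_ : a * e * Dv = a * e * b * h'
    + (a * e * d - d * (a * e)) * f' * b * e'
    + d * (a * e * (f' * b)) * e'); last by ncring.
  rewrite aef'b_normal; apply/subr0_eq.
  rewrite (_ : _ - _ = (a * e * d - d * (a * e)) * f' * b * e'
    - a * b * (h' * e - e * h' + h' * eps + eps * h')
    - a * (b * e - e * b - b * eps) * h'
    + (a * b - b * a) * h' * e + b * (a * h' - h' * a) * e
    - (a * d - d * a) * eta * b * e'
    + d * f' * (a * b) * (e * e' - e' * e + eps * (e - e'))
    + d * f' * (a * b - b * a) * (e' * e - eps * e)
    + d * f' * b * (a * e' - e' * a - a * eps) * e); last by ncring.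
  by rewrite !zeros.
rewrite 2!mulrDr mulrBr !mul_eps mul_phi mul_eta -mulrBr -!mulrDr.
congr (kp * _).
(* Two mismatches remain: [phi] against [eps], and the [eta] terms of the normal forms against the
   [eps] terms produced when [h] and [h'] pass [e'] and [e]. *)
have E1 := swap_phi_eps d (a * b) e'.
have E2 := swap_eta_eps a b 1.
rewrite (_ : a * e * Dv = a * e * b * h'
  + (a * e * d - d * (a * e)) * f' * b * e'
  + d * (a * e * (f' * b)) * e'); last by ncring.
rewrite (_ : b * e' * Du = b * e' * a * h
  + (b * e' * d - d * (b * e')) * f * a * e
  + d * (b * e' * (f * a)) * e); last by ncring.
rewrite aef'b_normal be'fa_normal; apply/subr0_eq.
rewrite (_ : _ - _ =
   (d * phi * (a * b) * (e - e') * e' - d * (f - f') * (a * b) * eps * e')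
   + (a * (d * eta) * b * (e - e') * 1 - a * (h' - h) * b * eps * 1)
   - (a * d - d * a) * eta * b * (e - e')
   - (a * e * d - d * (a * e)) * f' * b * e'
   + (b * e' * d - d * (b * e')) * f * a * e
   + a * b * (h' * e - e * h' + h' * eps + eps * h')
   - a * b * (h * e' - e' * h + h * eps + eps * h)
   + a * (b * e - e * b - b * eps) * h'
   - (a * b - b * a) * (e' * h - eps * h)
   - b * (a * e' - e' * a - a * eps) * h
   - a * (b * h' - h' * b) * (e' + eps) + a * (b * h - h * b) * (e' + eps)
   + d * (phi - f) * (a * b) * (e * e' - e' * e + eps * (e - e')));
  last by ncring.
by rewrite E1 E2 !subrr !zeros.
Qed.

End Relations.

Section ConverseRelations.
Variables (S : nzRingType) (dl kp pi d a b h h' e e' f f' eps phi eta : S).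
Hypothesis rel : current_relations dl kp pi d a b h h' e e' f f' eps phi eta.

Local Notation Du := (a * h + d * (f * a * e)).
Local Notation Dv := (b * h' + d * (f' * b * e')).

Lemma AC_relation :
  dl * (a * (f' * b) - f' * b * a) = kp * (a * (f' * b) - b * (f * a)).
Proof.
have E : (f' * b * a - a * (f' * b)) * dl = (b * (f * a) - a * (f' * b)) * kp.
  exact: (AB_relation (current_relations_rev rel)).
apply: oppr_inj; rewrite -[LHS]mulrN -[RHS]mulrN !opprB.
by rewrite -(dlC rel) -(kpC rel).
Qed.

Lemma CC_relation : f * a * (f' * b) - f' * b * (f * a) = 0.
Proof.
have E : f' * b * (f * a) - f * a * (f' * b) = 0.
  exact: (BB_relation (current_relations_rev rel)).
by rewrite -opprB E oppr0.
Qed.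

Lemma CD_relation :
  dl * (f * a * Dv - Dv * (f * a)) = kp * (Du * (f' * b) - Dv * (f * a)).
Proof.
have E : ((h' * b + f' * (b * e') * d) * (f * a)
    - f * a * (h' * b + f' * (b * e') * d)) * dl
  = ((h' * b + f' * (b * e') * d) * (f * a)
    - (h * a + f * (a * e) * d) * (f' * b)) * kp.
  have := BD_relation (current_relations_rev rel).
  rewrite -[LHS]/((_ * (f * a) - f * a * _) * dl).
  exact.
(* Read in [S^c], the two copies of [D] have the factors of [a * h] and [b * h'] reversed and [d] on
   the right; this restores [Du] and [Dv]. *)
rewrite !(dC rel) -(bh'C rel) -(ahC rel) !mulrA in E.
by apply: oppr_inj; rewrite -[LHS]mulrN -[RHS]mulrN !opprB -(dlC rel) -(kpC rel) !mulrA.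
Qed.

End ConverseRelations.

(** * The Cartan matrix *)

HB.instance Definition _ (K : fieldType) (g : vectType K) (br : lie_bracket g) x :=
  GRing.isLinear.Build K g g *:%R (lbr br x) (lbr_linearr br x).

Section Bracket.
Variables (K : fieldType) (g : vectType K) (br : lie_bracket g).

Lemma lbrDl x y z : br (x + y) z = br x z + br y z.
Proof. by have := lbr_linearl br z 1 x y; rewrite !scale1r. Qed.

Lemma lbr0l z : br 0 z = 0.
Proof. by apply: (addrI (br 0 z)); rewrite -lbrDl !addr0. Qed.

Lemma lbrZl k x z : br (k *: x) z = k *: br x z.
Proof. by have := lbr_linearl br z k x 0; rewrite lbr0l !addr0. Qed.

Lemma lbrNl x z : br (- x) z = - br x z.
Proof. by rewrite -scaleN1r lbrZl scaleN1r. Qed.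

Lemma lbrC x y : br x y = - br y x.
Proof.
apply/eqP; rewrite -addr_eq0; apply/eqP.
have := lbr_alt br (x + y).
by rewrite lbrDl !linearD /= !lbr_alt add0r addr0.
Qed.

Lemma lbr_leibniz x y z : br x (br y z) = br (br x y) z + br y (br x z).
Proof.
have := lbr_jacobi br x y z.
rewrite (lbrC z (br x y)) (lbrC z x) linearN /= => /eqP.
by rewrite subr_eq0 => /eqP <-; rewrite addrAC addrK.
Qed.

End Bracket.

(** * Traces and the Killing form *)

Section Trace.
Variables (K : fieldType) (V : vectType K).

Definition basis_trace n (e : n.-tuple V) (f : V -> V) : K :=
  \sum_i coord e i (f e`_i).

(** Both traces are the same double sum of products of coordinates. Allowing two bases gives
    cyclicity and independence of the basis at once. *)
Lemma basis_traceC n m (e : n.-tuple V) (e' : m.-tuple V)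
    (f k : {linear V -> V}) : basis_of fullv e -> basis_of fullv e' ->
  basis_trace e (f \o k) = basis_trace e' (k \o f).
Proof.
move=> be be'; rewrite /basis_trace.
transitivity (\sum_(i < n) \sum_(j < m) coord e' j (k e`_i) * coord e i (f e'`_j)).
  apply: eq_bigr => i _ /=.
  rewrite {1}(coord_basis be' (memvf (k e`_i))) !linear_sum /=.
  by apply: eq_bigr => j _; rewrite !linearZ.
rewrite exchange_big; apply: eq_bigr => j _ /=.
rewrite {2}(coord_basis be (memvf (f e'`_j))) !linear_sum /=.
by apply: eq_bigr => i _; rewrite !linearZ /= mulrC.
Qed.

End Trace.

Section Killing.
Variables (K : fieldType) (g : vectType K) (br : lie_bracket g).

Definition killing x y : K := basis_trace (vbasis fullv) (br x \o br y).

Lemma killingC x y : killing x y = killing y x.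
Proof. by apply: basis_traceC; exact: vbasisP. Qed.

Lemma killingE n (e : n.-tuple g) x y : basis_of fullv e ->
  killing x y = \sum_i coord e i (br x (br y e`_i)).
Proof. by move=> be; rewrite killingC; apply: basis_traceC => //; exact: vbasisP. Qed.

Lemma killingZr x y k : killing x (k *: y) = k * killing x y.
Proof.
rewrite /killing /basis_trace mulr_sumr; apply: eq_bigr => i _ /=.
by rewrite lbrZl !linearZ.
Qed.

Lemma killingDl x y z : killing (x + y) z = killing x z + killing y z.
Proof.
rewrite /killing /basis_trace -big_split; apply: eq_bigr => i _ /=.
by rewrite lbrDl linearD.
Qed.

Lemma killing_suml (I : finType) (c : I -> K) (x : I -> g) z :
  killing (\sum_i c i *: x i) z = \sum_i c i * killing (x i) z.
Proof.
have kZl k y : killing (k *: y) z = k * killing y z.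
  by rewrite killingC killingZr killingC.
have k0 : killing 0 z = 0 by rewrite -(scale0r 0) kZl mul0r.
rewrite (big_morph (killing^~ z) (fun x y => killingDl x y z) k0).
by apply: eq_bigr => i _; rewrite kZl.
Qed.

(** The Leibniz rule makes the adjoint action of a bracket a commutator; the two differences of
    traces then match up to a cyclic permutation. *)
Lemma killing_invariant x y z : killing (br x y) z = killing x (br y z).
Proof.
have E1 : killing (br x y) z = basis_trace (vbasis fullv) (br x \o (br y \o br z))
    - basis_trace (vbasis fullv) (br y \o (br x \o br z)).
  rewrite /killing /basis_trace -sumrB; apply: eq_bigr => i _ /=.
  by rewrite (lbr_leibniz br x y) linearD addrK.
have E2 : killing x (br y z) = basis_trace (vbasis fullv) (br x \o (br y \o br z))
    - basis_trace (vbasis fullv) ((br x \o br z) \o br y).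
  rewrite /killing /basis_trace -sumrB; apply: eq_bigr => i _ /=.
  by rewrite (lbr_leibniz br y z) linearD /= linearD addrK.
rewrite E1 E2; congr (_ - _).
by apply: (@basis_traceC _ _ _ _ _ _ (br y) (br x \o br z)); exact: vbasisP.
Qed.

End Killing.

(** * Strings of eigenvectors for sl2-triples *)

Section Sl2.
Variables (K : numFieldType) (g : vectType K) (br : lie_bracket g).

(** Diagonalisability of [h] is part of the notion: it is available in a toral subalgebra and
    supplies the eigenbasis used below. *)
Definition sl2_triple (e h f : g) : Prop :=
  [/\ br h e = 2 *: e, br h f = - (2 *: f), br e f = h & ad_diagonalizable br h].

Lemma sl2_triple_opp e h f : sl2_triple e h f -> sl2_triple f (- h) e.
Proof.
move=> [he hf ef [b [bb bh]]]; split; rewrite ?lbrNl ?he ?hf ?opprK //.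
  by rewrite lbrC ef.
exists b; split=> // y /bh[c hy]; exists (- c).
by rewrite lbrNl hy scaleNr.
Qed.

Lemma eigenvalue_in_basis n (b : n.-tuple g) h x mu : basis_of fullv b ->
  (forall i : 'I_n, exists c, br h b`_i = c *: b`_i) -> x != 0 -> br h x = mu *: x ->
  exists i : 'I_n, br h b`_i = mu *: b`_i.
Proof.
move=> bb bh x0 hx.
have [i xi] : exists i, coord b i x != 0.
  apply/existsP; apply: contraNT x0; rewrite negb_exists => /forallP x0.
  rewrite (coord_basis bb (memvf x)) big1 // => i _.
  by have := x0 i; rewrite negbK => /eqP ->; rewrite scale0r.
exists i; have [c bhi] := fin_all_exists bh; rewrite bhi; congr (_ *: _).
apply/(mulIf xi)/esym.
have := congr1 (coord b i) hx; rewrite linearZ /= => <-.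
rewrite {1}(coord_basis bb (memvf x)) linear_sum /=.
under eq_bigr do rewrite linearZ /= bhi scalerA.
by rewrite coord_sum_free ?(basis_free bb) // mulrC.
Qed.

(** If no [v k] vanished, the pairwise distinct eigenvalues [mu + dl *+ k] would all occur in a
    finite eigenbasis, giving an injection from [size b + 1] indices into [size b]. *)
Lemma eigenvector_chain h (v : nat -> g) (mu dl : K) :
  ad_diagonalizable br h -> dl != 0 ->
  (forall k, br h (v k) = (mu + dl *+ k) *: v k) -> exists k, v k = 0.
Proof.
move=> [b [bb bh]] dl0 hv.
pose t := in_tuple b; have bt : basis_of fullv t by [].
have bht (i : 'I_(size b)) : exists c, br h t`_i = c *: t`_i.
  by apply: bh; rewrite mem_nth.
apply: contrapT => /forallNP v0.
have {}v0 k : v k != 0 by apply/eqP/v0.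
have /fin_all_exists[i hi] (k : 'I_(size b).+1) :=
  eigenvalue_in_basis bt bht (v0 k) (hv k).
have inj_i : injective i.
  move=> k1 k2 eq_i; have := hi k1; rewrite eq_i hi => /eqP.
  rewrite -subr_eq0 -scalerBl scaler_eq0.
  rewrite (negPf (basis_not0 bt (mem_nth _ _))) ?orbF //.
  rewrite opprD addrACA subrr add0r subr_eq0.
  rewrite -[dl *+ k1]mulr_natr -[dl *+ k2]mulr_natr => /eqP /(mulfI dl0) /eqP.
  by rewrite eqr_nat => /eqP /val_inj.
by have := leq_card i inj_i; rewrite !card_ord ltnn.
Qed.

Lemma iter_raise e h f x mu k : sl2_triple e h f -> br h x = mu *: x ->
  br h (iter k (br e) x) = (mu + 2 *+ k) *: iter k (br e) x.
Proof.
move=> [he _ _ _] hx; elim: k => [|k IHk]; first by rewrite addr0.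
rewrite iterS lbr_leibniz he IHk lbrZl linearZ /= -scalerDl; congr (_ *: _).
by rewrite mulrSr addrCA [RHS]addrC addrC; ring.
Qed.

Lemma raise_top e h f x mu : sl2_triple e h f -> x != 0 -> br h x = mu *: x ->
  exists k, iter k (br e) x != 0 /\ br e (iter k (br e) x) = 0.
Proof.
move=> sl2 x0 hx; have [_ _ _ diag_h] := sl2.
have [k0 vk0] : exists k, iter k (br e) x = 0.
  apply: (eigenvector_chain (mu := mu) (dl := 2) diag_h); rewrite ?pnatr_eq0 //.
  by move=> k; exact: (iter_raise k sl2 hx).
have ex0 : exists k, iter k (br e) x == 0 by exists k0; exact/eqP.
case: (ex_minnP ex0) => -[|k] /eqP vk mink.
  by rewrite -[x]/(iter 0 (br e) x) vk eqxx in x0.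
by exists k; split=> //; apply/negP => /mink; rewrite ltnn.
Qed.

(** On the string through [x], [f] sends [e^(n+1) x] to [-(n+1)(mu + n) e^n x]. At the last nonzero
    vector [e^k x] this must be 0, so [mu = -k]. *)
Lemma lowest_weight e h f x mu :
  sl2_triple e h f -> x != 0 -> br h x = mu *: x -> br f x = 0 ->
  exists m : nat, mu = - m%:R.
Proof.
move=> sl2 x0 hx fx; have [k [xk0 exk]] := raise_top sl2 x0 hx; exists k.
have [he hf ef _] := sl2.
have fe n : br f (iter n.+1 (br e) x) = - (n.+1%:R * (mu + n%:R)) *: iter n (br e) x.
  elim: n => [|n IHn].
    rewrite /= lbr_leibniz (lbrC br f e) ef fx linear0 addr0 lbrNl hx -scaleNr.
    by congr (_ *: _); ring.
  rewrite iterS lbr_leibniz (lbrC br f e) ef IHn lbrNl (iter_raise n.+1 sl2 hx).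
  rewrite -scaleNr linearZ -scalerDl; congr (_ *: _).
  by rewrite -[2 *+ _]mulr_natr -!natr1; ring.
have := fe k; rewrite /= exk linear0 => /esym/eqP.
rewrite scaler_eq0 (negPf xk0) orbF oppr_eq0 mulf_eq0 pnatr_eq0 /=.
by rewrite addr_eq0 => /eqP.
Qed.

(** The top of the string through [x] is a lowest vector for the triple [(f, -h, e)], whence
    [mu = m - 2k] with natural [m] and [k]. *)
Lemma eigenvalue_real e h f x mu :
  sl2_triple e h f -> x != 0 -> br h x = mu *: x -> mu \is Num.real.
Proof.
move=> sl2 x0 hx; have [k [xk0 exk]] := raise_top sl2 x0 hx.
have hxk : br (- h) (iter k (br e) x) = - (mu + 2 *+ k) *: iter k (br e) x.
  by rewrite lbrNl (iter_raise k sl2 hx) scaleNr.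
have [m /oppr_inj muE] := lowest_weight (sl2_triple_opp sl2) xk0 hxk exk.
by rewrite -[mu](addrK (2 *+ k)) muE; apply: rpredB; rewrite ?realn // rpredMn ?realn.
Qed.

(** In an eigenbasis the trace is a sum of squares of reals, and the eigenvalue 2 of [e] occurs
    among them, so the sum is positive. *)
Lemma killing_sl2_neq0 e h f : sl2_triple e h f -> e != 0 -> killing br h h != 0.
Proof.
move=> sl2 e0; have [he _ _ [b [bb bh]]] := sl2.
pose t := in_tuple b; have bt : basis_of fullv t by [].
have bht (i : 'I_(size b)) : exists c, br h t`_i = c *: t`_i.
  by apply: bh; rewrite mem_nth.
have [c hc] := fin_all_exists bht.
have creal i : c i \is Num.real.
  by apply: (eigenvalue_real sl2 _ (hc i)); exact: basis_not0 bt (mem_nth _ _).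
rewrite (killingE br h h bt); under eq_bigr => i _.
  rewrite hc linearZ /= hc scalerA linearZ /= coord_free ?(basis_free bt) // eqxx mulr1.
  over.
rewrite psumr_neq0 => [|i _]; last by rewrite -expr2 real_exprn_even_ge0.
have [i hi] := eigenvalue_in_basis bt bht e0 he.
apply/hasP; exists i; rewrite ?mem_index_enum //=.
have : c i *: t`_i = 2 *: t`_i by rewrite -hc.
move/eqP; rewrite -subr_eq0 -scalerBl scaler_eq0.
rewrite (negPf (basis_not0 bt (mem_nth _ _))) ?orbF // subr_eq0 => /eqP ->.
by rewrite mulr_gt0 // ltr0n.
Qed.

End Sl2.

(** * Simple roots, coroots and invertibility of the Cartan matrix *)

Section Cartan.
Variables (K : numFieldType) (g : vectType K) (br : lie_bracket g).
Variables (h : {vspace g}) (h_toral : toral br h).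
Variables (l : nat) (alpha : 'I_l -> dual h) (alpha_simple : simple_roots br alpha).
Variables (alphav : 'I_l -> subvs_of h).
Hypothesis alphav_coroot : forall i, is_coroot br (alpha i) (alphav i).

Lemma coroot_sl2 i : exists e f, [/\ in_root_space br (alpha i) e,
  in_root_space br (- alpha i) f, sl2_triple br e (vsval (alphav i)) f & e != 0].
Proof.
have [a2 [e [f [he hf ef]]]] := alphav_coroot i; exists e, f; split=> //.
  split=> //; first by rewrite he a2.
    by rewrite hf opp_lfunE a2 scaleNr.
  by case: h_toral => _; apply; exact: subvsP.
apply/eqP => e0; have : vsval (alphav i) = 0 by rewrite -ef e0 lbr0l.
move=> t0; have : alpha i (alphav i) = 0.
  by rewrite (_ : alphav i = 0) ?linear0 //; apply: val_inj.
by rewrite a2 => /eqP; rewrite pnatr_eq0.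
Qed.

Lemma simple_roots_free (c : 'I_l -> K) :
  \sum_i c i *: alpha i = 0 -> forall i, c i = 0.
Proof.
have [_ alpha_basis _] := alpha_simple.
have free_alpha : free [tuple alpha i | i < l].
  have -> : val [tuple alpha i | i < l] = [seq alpha i | i : 'I_l] by [].
  exact: basis_free alpha_basis.
move=> c0; move/freeP: free_alpha; apply; rewrite -[RHS]c0.
by apply: eq_bigr => i _; rewrite nth_mktuple.
Qed.

(** The difference [alpha j - alpha i] has simple-root coefficients of both signs, so it is not a
    root. Hence the [f] of the triple of [alpha i] kills a root vector of [alpha j], which is thus a
    lowest vector. *)
Lemma cartan_matrix_off (i j : 'I_l) : i != j ->
  exists m : nat, alpha j (alphav i) = - m%:R.
Proof.
move=> ij; have [alpha_root _ alpha_pm] := alpha_simple.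
have [e [f [he hf sl2 _]]] := coroot_sl2 i.
have [_ [x [x0 hx]]] := alpha_root j.
apply: (lowest_weight sl2 x0 (hx _)).
apply: contrapT => /eqP fx0.
have sumB c : alpha j - alpha i = \sum_k c k *: alpha k ->
    c j = 1 /\ c i = -1.
  move=> cE; have c0 : \sum_k (c k - (k == j)%:R + (k == i)%:R) *: alpha k = 0.
    transitivity (\sum_k c k *: alpha k - \sum_k (k == j)%:R *: alpha k
      + \sum_k (k == i)%:R *: alpha k).
      by rewrite -sumrB -big_split; apply: eq_bigr => k _ /=; rewrite scalerDl scalerBl.
    have delta m : \sum_k (k == m)%:R *: alpha k = alpha m.
      rewrite (bigD1 m) //= eqxx scale1r big1 ?addr0 // => k /negPf ->.
      by rewrite scale0r.
    by rewrite !delta -cE addrAC subrK subrr.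
  have cz := simple_roots_free c0.
  have := cz j; have := cz i.
  rewrite !eqxx (negPf ij) eq_sym (negPf ij) subr0 addr0 mulr1n.
  by move=> /eqP + /eqP; rewrite addr_eq0 subr_eq0 => /eqP -> /eqP ->.
have root_ji : is_root br (alpha j - alpha i).
  split.
    apply/eqP => E0; have [|/eqP] := sumB (fun=> 0); last by rewrite eq_sym oner_eq0.
    by rewrite E0 big1 // => k _; rewrite scale0r.
  exists (br f x); split=> // t; rewrite lbr_leibniz hf hx lbrZl linearZ /= -scalerDl.
  by congr (_ *: _); rewrite !lfunE /= addrC lfunE.
have [c [|]] := alpha_pm _ root_ji => cE.
  have [|_ /eqP] := sumB (fun k => (c k)%:R).
    by rewrite cE; apply: eq_bigr => k _; rewrite scaler_nat.
  by rewrite eq_sym -subr_eq0 -opprD oppr_eq0 -mulrS pnatr_eq0.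
have [|/eqP] := sumB (fun k => - (c k)%:R).
  by rewrite cE -sumrN; apply: eq_bigr => k _; rewrite scaleNr scaler_nat.
by rewrite eq_sym -subr_eq0 opprK -mulrS pnatr_eq0.
Qed.

Lemma coroots_free (c : 'I_l -> K) :
  \sum_i c i *: alphav i = 0 -> forall i, c i = 0.
Proof.
(* By invariance [killing e f] is the factor of [alpha i]; evaluating at the coroot itself, where
   [alpha i] is 2, expresses it as [q i] without reference to a triple. *)
move=> c0; pose q i := killing br (vsval (alphav i)) (vsval (alphav i)) / 2.
have q_neq0 i : q i != 0.
  have [e [f [_ _ sl2 e0]]] := coroot_sl2 i.
  by rewrite mulf_neq0 ?invr_eq0 ?pnatr_eq0 // (killing_sl2_neq0 sl2).
have killing_alpha i (t : subvs_of h) :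
    killing br (vsval (alphav i)) (vsval t) = q i * alpha i t.
  have [e [f [_ hf [_ _ ef _] _]]] := coroot_sl2 i.
  have [a2 _] := alphav_coroot i.
  have kt s : killing br (vsval (alphav i)) (vsval s) = alpha i s * killing br e f.
    rewrite -{1}ef killing_invariant lbrC hf opp_lfunE scaleNr opprK.
    exact: killingZr.
  by rewrite /q !kt a2 [2 * _]mulrC mulfK ?pnatr_eq0 // mulrC.
suff cq0 i : c i * q i = 0.
  by move=> i; apply: (mulIf (q_neq0 i)); rewrite cq0 mul0r.
apply: (@simple_roots_free (fun i => c i * q i)); apply/lfunP => t.
rewrite sum_lfunE zero_lfunE.
transitivity (killing br (\sum_i c i *: vsval (alphav i)) (vsval t)).
  rewrite killing_suml; apply: eq_bigr => k _.
  by rewrite killing_alpha scale_lfunE mulrA.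
have -> : \sum_i c i *: vsval (alphav i) = vsval (\sum_i c i *: alphav i).
  by rewrite linear_sum; apply: eq_bigr => k _; rewrite linearZ.
rewrite c0 /killing /basis_trace big1 // => k _ /=.
by rewrite lbr0l linear0.
Qed.

Variable a : 'M[int]_l.
Hypothesis aE : forall i j, (a i j)%:~R = alpha j (alphav i) :> K.

Lemma cartan_matrix_diag i : a i i = 2.
Proof.
by have [a2 _] := alphav_coroot i; have := aE i i; rewrite a2 => /eqP;
  rewrite (eqr_int K _ 2) => /eqP.
Qed.

Lemma cartan_matrix_off_le0 (i j : 'I_l) : i != j -> a i j <= 0.
Proof.
move=> /cartan_matrix_off[m]; rewrite -aE => /eqP.
rewrite (_ : - m%:R = (- m%:Z)%:~R); last by rewrite mulrNz.
by rewrite eqr_int => /eqP ->; rewrite oppr_le0.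
Qed.

(** A row vector in the kernel gives a combination [t] of coroots on which all simple roots vanish.
    These span the dual, so [t = 0], and the coroots are independent. *)
Lemma cartan_matrix_unit : map_mx intr a \in @unitmx K l.
Proof.
rewrite -row_free_unit; apply/inj_row_free => v va.
have alpha_basis : basis_of fullv [tuple alpha i | i < l] by case: alpha_simple.
pose t := \sum_s v 0 s *: alphav s.
have alpha_t i : alpha i t = 0.
  have := congr1 (fun w : 'rV_l => w 0 i) va; rewrite !mxE => <-.
  rewrite linear_sum; apply: eq_bigr => s _.
  by rewrite linearZ /= mxE aE.
have all_t (be : dual h) : be t = 0.
  rewrite (coord_basis alpha_basis (memvf be)) sum_lfunE big1 // => k _.
  by rewrite scale_lfunE nth_mktuple alpha_t scaler0.
have t0 : t = 0.
  rewrite (coord_vbasis (memvf t)) big1 // => k _.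
  have := all_t (linfun (coord (vbasis fullv) k : subvs_of h -> K^o)).
  by rewrite lfunE /= => ->; rewrite scale0r.
by apply/rowP => s; rewrite mxE; exact: (coroots_free t0).
Qed.

(** Stated for vectors with entries in a module, since the unknowns will be error coefficients in
    [Y]; the inverse matrix acts on them by scalars. *)
Lemma cartan_matrix_ker (V : lmodType K) (x : 'I_l -> V) :
  (forall i, \sum_s (a s i)%:~R *: x s = 0) -> forall s, x s = 0.
Proof.
move=> ax s; pose b := invmx (map_mx intr a : 'M[K]_l).
transitivity (\sum_i b i s *: \sum_t (a t i)%:~R *: x t); last first.
  by rewrite big1 // => i _; rewrite ax scaler0.
under eq_bigr do rewrite scaler_sumr.
rewrite exchange_big /= (eq_bigr (fun t => (t == s)%:R *: x t)) => [|t _].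
  rewrite (bigD1 s) //= eqxx scale1r big1 ?addr0 // => t /negPf ->.
  by rewrite scale0r.
have -> : (t == s)%:R = (map_mx intr a *m b) t s.
  by rewrite mulmxV ?cartan_matrix_unit // mxE.
by rewrite mxE scaler_suml; apply: eq_bigr => i _; rewrite scalerA mxE mulrC.
Qed.

End Cartan.

(** * Formal series and the substitution u -> u - c *)

Section Series.
Variable S : nzRingType.
Implicit Types f g h : fps S.

Lemma fps_coefD f g n : (f + g) n = f n + g n. Proof. by []. Qed.
Lemma fps_coefN f n : (- f) n = - f n. Proof. by []. Qed.
Lemma fps_coefB f g n : (f - g) n = f n - g n. Proof. by []. Qed.
Lemma fps_coef1 n : (1 : fps S) n = (n == 0)%:R.
Proof. by rewrite -[LHS]/(if n == 0 then 1 else 0); case: eqP. Qed.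

Fact fps_const_zmod : zmod_morphism (@fps_const S).
Proof.
move=> x y; apply/funext => n; rewrite fps_coefB /fps_const.
by case: eqP => // _; rewrite subrr.
Qed.
Fact fps_const_monoid : monoid_morphism (@fps_const S).
Proof.
split=> // x y; apply/funext => n; rewrite fps_coefM big_ord_recl big1 => [|i _].
  by rewrite addr0 subn0 /fps_const; case: eqP => // _; rewrite mulr0.
by rewrite /fps_const mul0r.
Qed.
HB.instance Definition _ :=
  GRing.isZmodMorphism.Build S (fps S) (@fps_const S) fps_const_zmod.
HB.instance Definition _ :=
  GRing.isMonoidMorphism.Build S (fps S) (@fps_const S) fps_const_monoid.

Lemma fps_coef_constM x f n : (fps_const x * f) n = x * f n.
Proof.
rewrite fps_coefM big_ord_recl big1 ?addr0 ?subn0 // => i _.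
by rewrite /fps_const mul0r.
Qed.

Lemma fps_coefMconst x f n : (f * fps_const x) n = f n * x.
Proof.
rewrite fps_coefM big_ord_recr /= subnn big1 ?add0r // => i _.
by rewrite /fps_const subn_eq0 leqNgt ltn_ord mulr0.
Qed.

Lemma fps_commP f g : (forall m n, f m * g n = g n * f m) -> f * g = g * f.
Proof.
move=> fgC; apply/funext => n; rewrite !fps_coefM (reindex_inj rev_ord_inj) /=.
apply: eq_bigr => i _; rewrite fgC subSS; congr (g _ * f _).
by rewrite subKn // -ltnS.
Qed.

Lemma fps_uinvC f : fps_uinv S * f = f * fps_uinv S.
Proof.
apply: fps_commP => m n; rewrite /fps_uinv.
by case: (m == 1); rewrite ?mul1r ?mulr1 ?mul0r ?mulr0.
Qed.

Lemma fps_coef_uinv0 f : (fps_uinv S * f) 0 = 0.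
Proof. by rewrite fps_coefM big_ord1 mul0r. Qed.

Lemma fps_coef_uinvS f n : (fps_uinv S * f) n.+1 = f n.
Proof.
rewrite fps_coefM 2!big_ord_recl big1 /= => [|i _]; last by rewrite mul0r.
by rewrite mul0r add0r addr0 mul1r subn1.
Qed.

Lemma fps_inv_comm f g :
  f 0 = 1 -> f * g = g * f -> fps_inv f * g = g * fps_inv f.
Proof.
move=> f0 fgC; rewrite -[LHS]mulr1 -(fps_mulrV f0) mulrA -(mulrA _ g) -fgC.
by rewrite !mulrA fps_mulVr // mul1r.
Qed.

End Series.

Section Shift.
Variables (K : nzRingType) (S : algType K) (c : K).
Implicit Types f g h : fps S.

Lemma fps_coefZ (k : K) f n : (k *: f) n = k *: f n. Proof. by []. Qed.

(** Here [q] is [(u - c) / u], and [w] is the expansion of [(u - c)^-1]. *)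
Let q : fps S := 1 - c *: fps_uinv S.
Let w : fps S := fps_uinv S * fps_inv q.

Lemma shift_denom0 : q 0 = 1.
Proof. by rewrite /q fps_coefB fps_coefZ fps_coef1 /fps_uinv /= scaler0 subr0. Qed.

Lemma shift_denomC f : q * f = f * q.
Proof. by rewrite /q mulrBl mulrBr mul1r mulr1 -scalerAl -scalerAr fps_uinvC. Qed.

Lemma shift_denomVC f : fps_inv q * f = f * fps_inv q.
Proof. by apply: fps_inv_comm; [exact: shift_denom0 | exact: shift_denomC]. Qed.

Lemma shift_varC f : w * f = f * w.
Proof. by rewrite /w -mulrA shift_denomVC mulrA fps_uinvC mulrA. Qed.

Let w0 : w 0 = 0. Proof. exact: fps_coef_uinv0. Qed.

(** Substitution of [w] for [u^-1] in a polynomial. It is multiplicative because [w] is central, and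
    since [w] has no constant term, truncations determine each coefficient of a shifted series. *)
Let ev (p : {poly S}) : fps S := (map_poly (@fps_const S) p).[w].

Let evM : {morph ev : p r / p * r}.
Proof.
move=> p r; rewrite /ev rmorphM /= hornerM_comm //.
by rewrite /comm_poly shift_varC.
Qed.

Let evE (p : {poly S}) n : ev p n = \sum_(i < n.+1) p`_i * (w ^+ i) n.
Proof.
rewrite /ev (@horner_coef_wide _ (maxn (size p) n.+1)); last first.
  exact: leq_trans (size_poly _ _) (leq_maxl _ _).
rewrite fps_coef_sum [RHS](big_ord_widen (maxn (size p) n.+1)
  (fun i => p`_i * (w ^+ i) n)) ?leq_maxr // [RHS]big_mkcond /=.
apply: eq_bigr => i _; rewrite coef_map fps_coef_constM.
by case: leqP => // ni; rewrite fps_coef_exp_small ?mulr0.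
Qed.

Lemma fps_shiftE f N n : (n < N)%N ->
  fps_shift c f n = (map_poly (@fps_const S) (\poly_(i < N) f i)).[w] n.
Proof.
move=> nN; rewrite -[RHS]/(ev _ n) evE; apply: eq_bigr => i _.
by rewrite coef_poly (leq_trans (ltn_ord i)).
Qed.

Lemma fps_shiftM : {morph fps_shift c : f g / f * g :> fps S}.
Proof.
move=> f g; apply/funext => n; pose P (x : fps S) := \poly_(i < n.+1) x i.
transitivity (ev (P f * P g) n).
  rewrite evE; apply: eq_bigr => i _; congr (_ * _).
  exact: (@fps_mul_poly _ n.+1).
rewrite evM fps_coefM fps_coefM; apply: eq_bigr => i _.
by rewrite !(@fps_shiftE _ n.+1) // ltnS leq_subr.
Qed.

Lemma fps_shiftB : {morph fps_shift c : f g / f - g :> fps S}.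
Proof.
move=> f g; apply/funext => n; rewrite /fps_shift fps_coefB -sumrB.
by apply: eq_bigr => i _; rewrite mulrBl.
Qed.

Lemma fps_shift_const x : fps_shift c (fps_const x) = fps_const x :> fps S.
Proof.
apply/funext => n; rewrite /fps_shift big_ord_recl big1 => [|i _].
  by case: n => [|n]; rewrite expr0 fps_coef1 addr0 /= ?mulr1 ?mulr0.
by rewrite /fps_const mul0r.
Qed.

Lemma fps_shift_uinv : fps_shift c (fps_uinv S) = w.
Proof.
apply/funext => -[|n]; first by rewrite /fps_shift big_ord1 mul0r w0.
rewrite /fps_shift 2!big_ord_recl big1 => [|i _]; last by rewrite mul0r.
by rewrite mul0r add0r addr0 mul1r.
Qed.

(** The power [w ^+ m] starts with [u^-m] with coefficient 1. This is why shifts are invisible in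
    lowest-order terms. *)
Lemma fps_shift_lead f n : (forall m, (m < n)%N -> f m = 0) ->
  forall m, (m <= n)%N -> fps_shift c f m = f m.
Proof.
move=> f0 m le_mn; rewrite /fps_shift big_ord_recr /= big1 ?add0r => [|i _].
  case: (ltnP m n) => [/f0->|nm]; first by rewrite mul0r.
  suff -> : (w ^+ m) m = 1 by rewrite mulr1.
  elim: m {le_mn nm} => [|m IHm]; first by rewrite expr0.
  rewrite exprS /w -mulrA fps_coef_uinvS fps_coefM big_ord_recl big1 => [|i _].
    rewrite subn0 IHm mulr1 addr0.
    have := congr1 (fun f : fps S => f 0) (fps_mulrV shift_denom0).
    by rewrite fps_coefM big_ord1 shift_denom0 mul1r.
  rewrite -/w fps_coef_exp_small ?mulr0 //=.
  by rewrite /bump; have := ltn_ord i; lia.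
by rewrite f0 ?mul0r // (leq_trans (ltn_ord i)).
Qed.

End Shift.

(** * Series intertwining shifted currents *)

Section Leading.
Variable S : nzRingType.
Implicit Types f g : fps S.

(** The coefficient [x] may be 0, so [n] is only a lower bound for the order. *)
Definition leading (n : nat) f (x : S) : Prop :=
  (forall m, (m < n)%N -> f m = 0) /\ f n = x.

Lemma leadingD n f g x y :
  leading n f x -> leading n g y -> leading n (f + g) (x + y).
Proof.
move=> [f0 <-] [g0 <-]; split=> // m mn.
by rewrite fps_coefD f0 // g0 // addr0.
Qed.

Lemma leadingMl n f g x : g 0 = 1 -> leading n f x -> leading n (g * f) x.
Proof.
move=> g1 [f0 <-]; split=> [m mn|].
  by rewrite fps_coefM big1 // => i _; rewrite f0 ?mulr0 //; lia.
rewrite fps_coefM big_ord_recl big1 ?subn0 ?g1 ?mul1r ?addr0 // => i _.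
by rewrite f0 ?mulr0 // /= /bump; have := ltn_ord i; lia.
Qed.

Lemma leadingMr n f g x : g 0 = 1 -> leading n f x -> leading n (f * g) x.
Proof.
move=> g1 [f0 <-]; split=> [m mn|].
  rewrite fps_coefM big1 // => i _; rewrite f0 ?mul0r //.
  by have := ltn_ord i; lia.
rewrite fps_coefM big_ord_recr big1 /= ?subnn ?g1 ?mulr1 ?add0r // => i _.
by rewrite f0 ?mul0r.
Qed.

Lemma leading_uinv n f : (forall m, (m < n)%N -> f m = 0) ->
  leading n (fps_uinv S * f) 0.
Proof.
move=> f0; split=> [[|m] mn|]; rewrite ?fps_coef_uinv0 ?fps_coef_uinvS ?f0 //.
  exact: ltnW.
by case: n f0 => [|n] f0; rewrite ?fps_coef_uinv0 ?fps_coef_uinvS ?f0.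
Qed.

Lemma leading_inj n f x y : leading n f x -> leading n f y -> x = y.
Proof. by move=> [_ <-] [_ <-]. Qed.

End Leading.

Lemma leading_shift (K : nzRingType) (S : algType K) (c : K) n (f : fps S) x :
  leading n f x -> leading n (fps_shift c f) x.
Proof.
move=> [f0 <-]; split=> [m mn|]; last exact: (fps_shift_lead c f0).
by rewrite (fps_shift_lead c f0) ?f0 // ltnW.
Qed.

Section Intertwining.
Variables (K : nzRingType) (S : algType K) (b : bool).
Implicit Types (f g h X Z : fps S) (th : K).

(* The currents F obey the relations of the currents E in the opposite ring. *)
Definition bmul f g : fps S := if b then f * g else g * f.

Lemma bmulA f g h : bmul f (bmul g h) = bmul (bmul f g) h.
Proof. by rewrite /bmul; case: b; rewrite mulrA. Qed.

Lemma bmulBl f g h : bmul (f - g) h = bmul f h - bmul g h.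
Proof. by rewrite /bmul; case: b; rewrite ?mulrBl ?mulrBr. Qed.

Lemma bmulBr f g h : bmul h (f - g) = bmul h f - bmul h g.
Proof. by rewrite /bmul; case: b; rewrite ?mulrBl ?mulrBr. Qed.

Lemma bmulDl f g h : bmul (f + g) h = bmul f h + bmul g h.
Proof. by rewrite /bmul; case: b; rewrite ?mulrDl ?mulrDr. Qed.

Lemma bmulDr f g h : bmul h (f + g) = bmul h f + bmul h g.
Proof. by rewrite /bmul; case: b; rewrite ?mulrDl ?mulrDr. Qed.

Lemma bmulZl c f g : bmul (c *: f) g = c *: bmul f g.
Proof. by rewrite /bmul; case: b; rewrite -?scalerAl -?scalerAr. Qed.

Lemma bmulZr c f g : bmul f (c *: g) = c *: bmul f g.
Proof. by rewrite /bmul; case: b; rewrite -?scalerAl -?scalerAr. Qed.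

Lemma bmulCl z f g : (forall x, z * x = x * z) -> bmul (z * f) g = z * bmul f g.
Proof. by move=> zC; rewrite /bmul; case: b; rewrite mulrA // -zC mulrA. Qed.

Lemma bmulCr z f g : (forall x, z * x = x * z) -> bmul f (z * g) = z * bmul f g.
Proof. by move=> zC; rewrite /bmul; case: b; rewrite mulrA // -zC mulrA. Qed.

Lemma bmul_comm f g : f * g = g * f -> bmul f g = f * g.
Proof. by rewrite /bmul; case: b. Qed.

Lemma bmul0 f g : f 0 = 1 -> g 0 = 1 -> bmul f g 0 = 1.
Proof.
by move=> f1 g1; rewrite /bmul; case: b; rewrite fps_coefM big_ord1 f1 g1 mul1r.
Qed.

Lemma leading_bmull n f g x : g 0 = 1 -> leading n f x -> leading n (bmul g f) x.
Proof. by rewrite /bmul; case: b; [exact: leadingMl | exact: leadingMr]. Qed.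

Lemma leading_bmulr n f g x : g 0 = 1 -> leading n f x -> leading n (bmul f g) x.
Proof. by rewrite /bmul; case: b; [exact: leadingMr | exact: leadingMl]. Qed.

(* With w the shift of the index r, this is (u - w - th) / u applied to G. *)
Definition lam th (G : nat -> fps S) r : fps S :=
  G r - fps_uinv S * (G r.+1 + th *: G r).

Lemma bmul_laml X th G r : bmul (lam th G r) X = lam th (fun r => bmul (G r) X) r.
Proof.
by rewrite /lam bmulBl bmulCl ?bmulDl ?bmulZl //; exact: fps_uinvC.
Qed.

Lemma bmul_lamr X th G r : bmul X (lam th G r) = lam th (fun r => bmul X (G r)) r.
Proof.
by rewrite /lam bmulBr bmulCr ?bmulDr ?bmulZr //; exact: fps_uinvC.
Qed.

(** The terms multiplied by [u^-1] start one order later, so neither [th] nor the next mode is seen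
    at order [n]. *)
Lemma leading_lam n th (G : nat -> fps S) (x : nat -> S) :
  (forall r, leading n (G r) (x r)) -> forall r, leading n (lam th G r) (x r).
Proof.
move=> Gx r; rewrite -[x r]addr0; apply: leadingD => //.
rewrite -mulrN; apply: leading_uinv => m mn.
rewrite fps_coefN fps_coefD fps_coefZ.
have [[G0 _] [G1 _]] := (Gx r, Gx r.+1).
by rewrite G0 // G1 // scaler0 addr0 oppr0.
Qed.

Variable E : nat -> S.

Definition currents r : fps S := fps_const (E r).

Definition defect X th th' r : fps S :=
  bmul X (lam th currents r) - bmul (lam th' currents r) X.

(** An approximate relation: passing [X] changes the parameter [th] into [th'] below order [n], and
    [dl] is the error at order [n]. *)
Definition intertwines n X th th' (dl : nat -> S) : Prop :=
  X 0 = 1 /\ (forall r, leading n (defect X th th' r) (dl r)).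

(** The defect of a product obeys a Leibniz rule, and the outer factors, having constant term 1,
    leave the errors of order [n] unchanged. *)
Lemma intertwines_mul n X Z t1 t2 t3 dl dl' :
  intertwines n Z t1 t2 dl -> intertwines n X t2 t3 dl' ->
  intertwines n (bmul X Z) t1 t3 (fun r => dl r + dl' r).
Proof.
move=> [Z0 Zdl] [X0 Xdl]; split=> [|r]; first exact: bmul0.
rewrite /defect (_ : _ - _ =
  bmul X (defect Z t1 t2 r) + bmul (defect X t2 t3 r) Z).
  by apply: leadingD; [apply: leading_bmull | apply: leading_bmulr].
by rewrite /defect bmulBl bmulBr !bmulA addrA subrK.
Qed.

(** At [u - e] the factor [(u - w - th) / u] becomes [(u - w - th - e) / (u - e)]; the prefactor
    [(u - e) / u] restores the denominator [u]. *)
Lemma lam_shift e th r : (1 - e *: fps_uinv S) *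
  fps_shift e (lam th currents r) = lam (th + e) currents r.
Proof.
rewrite /lam; have constZ k x : k *: fps_const x = fps_const (k *: x) :> fps S.
  apply/funext => n; rewrite fps_coefZ /fps_const.
  by case: eqP; rewrite // scaler0.
rewrite constZ -rmorphD fps_shiftB fps_shiftM fps_shift_uinv !fps_shift_const.
rewrite mulrBr !mulrA -[_ * fps_uinv S]fps_uinvC.
rewrite -[_ * _ * fps_inv _]mulrA fps_mulrV ?shift_denom0 // mulr1 mulrBl mul1r.
rewrite -addrA; congr (_ + _).
rewrite -opprD -scalerAl scalerAr -mulrDr constZ scalerDl [in RHS]addrC.
congr (- (_ * _)); rewrite !constZ rmorphD /= [LHS]addrC [RHS]addrC.
by rewrite -addrA.
Qed.

Lemma intertwines_shift n X t1 t2 dl e : intertwines n X t1 t2 dl ->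
  intertwines n (fps_shift e X) (t1 + e) (t2 + e) dl.
Proof.
move=> [X0 Xdl]; split=> [|r]; first by rewrite (@fps_shift_lead _ _ _ _ 0).
have shiftM f g : fps_shift e (bmul f g) = bmul (fps_shift e f) (fps_shift e g).
  by rewrite /bmul; case: b; rewrite fps_shiftM.
rewrite (_ : defect _ _ _ r =
  (1 - e *: fps_uinv S) * fps_shift e (defect X t1 t2 r)).
  by apply: leadingMl; [exact: shift_denom0 | exact: leading_shift].
rewrite /defect fps_shiftB !shiftM mulrBr -!lam_shift.
by rewrite bmulCr ?bmulCl //; exact: shift_denomC.
Qed.

(** A series commuting with the modes up to an error preserves every parameter, so [th] can be
    chosen later to fit its neighbours in a product. *)
Lemma intertwines_comm n X th dl : X 0 = 1 ->
  (forall r, leading n (bmul X (currents r) - bmul (currents r) X) (dl r)) ->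
  intertwines n X th th dl.
Proof.
move=> X0 Xdl; split=> // r; rewrite /defect bmul_lamr bmul_laml.
rewrite (_ : _ - _ =
  lam th (fun r => bmul X (currents r) - bmul (currents r) X) r).
  exact: leading_lam.
rewrite /lam; move: (bmul X _) (bmul X _) (bmul _ X) (bmul _ X) => x y z t.
rewrite scalerBr addrACA -opprD mulrBr !opprB.
by rewrite addrACA [RHS]addrACA; congr (_ + _); rewrite addrC.
Qed.

Lemma intertwines1 n th : intertwines n 1 th th (fun=> 0).
Proof.
by split=> // r; rewrite /defect /bmul; case: b; rewrite mulr1 mul1r subrr.
Qed.

Lemma intertwines_chain n (X : nat -> fps S) (th : nat -> K) dl m :
  (forall i j, X i * X j = X j * X i) ->
  (forall k, intertwines n (X k.+1) (th k) (th k.+1) dl) ->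
  intertwines n (\prod_(1 <= k < m.+1) X k) (th 0) (th m) (fun r => dl r *+ m).
Proof.
move=> XC Xdl; elim: m => [|m IHm].
  by rewrite big_geq //; exact: intertwines1.
rewrite big_nat_recr //= -bmul_comm; last first.
  by apply/esym/commr_prod => i _; exact: XC.
have := intertwines_mul IHm (Xdl m); rewrite /bmul.
have -> : X m.+1 * \prod_(1 <= k < m.+1) X k =
    \prod_(1 <= k < m.+1) X k * X m.+1.
  by apply: commr_prod => i _; exact: XC.
by rewrite !if_same => -[X0 H]; split=> // r; rewrite mulrSr.
Qed.

(** Only [X j] may change the parameter. The [if] tells whether it has already been met, which is
    why every other factor must accept any [th]. *)
Lemma intertwines_prod n (I : eqType) (r : seq I) (P : pred I) (j : I)
    (X : I -> fps S) t t' dl :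
  uniq r -> (forall i k, X i * X k = X k * X i) ->
  (forall i, P i -> i != j -> forall th, intertwines n (X i) th th (dl i)) ->
  (P j -> intertwines n (X j) t t' (dl j)) ->
  intertwines n (\prod_(i <- r | P i) X i) t (if (j \in r) && P j then t' else t)
    (fun k => \sum_(i <- r | P i) dl i k).
Proof.
move=> + XC Xdl Xj; elim: r => [_|i r IHr /= /andP[ir /IHr {}IHr]].
  have := intertwines1 n t; rewrite big_nil => -[H0 H1]; split=> // k.
  by rewrite big_nil; exact: H1.
rewrite big_cons; case: ifPn => Pi; last first.
  have -> : (j \in i :: r) && P j = (j \in r) && P j.
    by rewrite inE; case: eqP => [->|//]; rewrite (negPf Pi) !andbF.
  by case: IHr => H0 H1; split=> // k; rewrite big_cons (negPf Pi).
have XrC : X i * (\prod_(i <- r | P i) X i) = (\prod_(i <- r | P i) X i) * X i.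
  by apply: commr_prod => k _; exact: XC.
rewrite -(bmul_comm XrC).
have {}IHr := intertwines_mul IHr
  (t3 := if (j \in i :: r) && P j then t' else t) (dl' := dl i).
have /IHr[] : intertwines n (X i) (if (j \in r) && P j then t' else t)
    (if (j \in i :: r) && P j then t' else t) (dl i).
  case: (eqVneq i j) => [ij|nij].
    by rewrite -ij (negPf ir) mem_head Pi /= ij; apply: Xj; rewrite -ij.
  by rewrite inE eq_sym (negPf nij) /=; exact: Xdl.
by move=> H0 H1; split=> // k; rewrite big_cons Pi addrC.
Qed.

End Intertwining.

(** * Commutation of the A_i with the currents *)

Definition coef_comm (S : nzRingType) (f g : fps S) : Prop :=
  forall m n, f m * g n = g n * f m.

Lemma coef_comm_sym (S : nzRingType) (f g : fps S) : coef_comm f g -> coef_comm g f.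
Proof. by move=> fg m n; rewrite fg. Qed.

(** Each [g n], viewed as a constant series, is unaffected by the shift. *)
Lemma coef_comm_shift (K : nzRingType) (S : algType K) (c : K) (f g : fps S) :
  coef_comm f g -> coef_comm (fps_shift c f) g.
Proof.
move=> fg m n; have fC : f * fps_const (g n) = fps_const (g n) * f.
  by apply/funext => k; rewrite fps_coefMconst fps_coef_constM fg.
have := congr1 (fun x : fps S => fps_shift c x m) fC.
by rewrite !fps_shiftM !fps_shift_const fps_coefMconst fps_coef_constM.
Qed.

Section CurrentsOfA.
Variables (K : numClosedFieldType) (l : nat) (a : 'M[int]_l) (d : 'I_l -> nat).
Variables (hbar : K) (Y : algType K) (H A : 'I_l -> nat -> Y).
Hypothesis a_ker : forall x : 'I_l -> Y,
  (forall i, \sum_s (a s i)%:~R *: x s = 0) -> forall s, x s = 0.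
Hypothesis a_diag : forall i, a i i = 2.
Hypothesis a_off : forall i j, i != j -> a i j <= 0.
Hypothesis d_sym : forall i j, (d i)%:Z * a i j = (d j)%:Z * a j i.
Hypothesis AA_comm : forall i k, coef_comm (gen1 (A i)) (gen1 (A k)).
Hypothesis AH_comm : forall i k, coef_comm (gen1 (A i)) (gen1 (H k)).
Hypothesis A_fact : H_factorisation a d hbar H A.

Lemma gen1_0 (X : nat -> Y) : gen1 X 0 = 1.
Proof. by rewrite /gen1 fps_coefD addr0. Qed.

Variables (b : bool) (j : 'I_l) (E : nat -> Y).
Local Notation c := (kap a d hbar).
Hypothesis HE : forall i r,
  bmul b (gen1 (H i)) (lam (c i j) (currents E) r) =
  bmul b (lam (- c i j) (currents E) r) (gen1 (H i)).

(** The parameters [- c j j] and 0 fit the factorisation: [A_j(u - c_jj)], [H_j(u)] and [A_j(u)] in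
    turn carry 0 to [c j j], to [- c j j], and back to 0. *)
Definition A_defect i r : fps Y :=
  if i == j then defect b E (gen1 (A i)) (- c j j) 0 r
  else bmul b (gen1 (A i)) (currents E r) - bmul b (currents E r) (gen1 (A i)).

Let HE_intertwines n i : intertwines b E n (gen1 (H i)) (c i j) (- c i j) (fun=> 0).
Proof. by split=> [|r]; [exact: gen1_0 | rewrite /defect HE subrr]. Qed.

Lemma A_defect_eq0 i r : A_defect i r = 0.
Proof.
suff D0 n : forall i r m, (m < n)%N -> A_defect i r m = 0.
  by apply/funext => n; rewrite (D0 n.+1).
(* Once the defects vanish below order n, the factorisation says that their
   coefficients dl of order n satisfy \sum_s (a s i) dl_s = 0 for all i. *)
elim: n => // n IHn {}i {}r m; rewrite ltnS leq_eqVlt.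
case/orP=> [/eqP->{m}|]; last exact: IHn.
pose dl s k := A_defect s k n.
have lead s k : leading n (A_defect s k) (dl s k) by split=> // m; exact: IHn.
have A_other s th : s != j -> intertwines b E n (gen1 (A s)) th th (dl s).
  move=> sj; apply: intertwines_comm; first exact: gen1_0.
  by move=> k; have := lead s k; rewrite /A_defect (negPf sj).
have A_same : intertwines b E n (gen1 (A j)) (- c j j) 0 (dl j).
  split=> [|k]; first exact: gen1_0.
  by have := lead j k; rewrite /A_defect eqxx.
pose sh i s k := 'i * hbar / 2 * (rform a d i s + k%:Z * rform a d s s)%:~R : K.
pose P i s :=
  \prod_(1 <= k < (absz (- a s i)).+1) fps_shift (sh i s k) (gen1 (A s)).
have fact k : gen1 (A k) * (gen1 (H k) * fps_shift (c k k) (gen1 (A k))) =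
    \prod_(s <- index_enum 'I_l | s != k) P k s.
  rewrite mulrA (fps_commP (AH_comm k k)) -mulrA A_fact -[LHS]mulrA fps_mulVr ?mulr1 //.
  by rewrite fps_coefM big_ord1 gen1_0 (@fps_shift_lead _ _ _ _ 0) ?gen1_0 ?mul1r.
have shC e e' s t :
    coef_comm (fps_shift e (gen1 (A s))) (fps_shift e' (gen1 (A t))).
  by apply/coef_comm_shift/coef_comm_sym/coef_comm_shift.
have PC i1 i2 s t : P i1 s * P i2 t = P i2 t * P i1 s.
  apply/esym/commr_prod => k _; apply/commr_sym/commr_prod => k' _.
  exact/fps_commP/shC.
have P_other k s th : s != j ->
    intertwines b E n (P k s) th th (fun r => dl s r *+ absz (- a s k)).
  move=> sj; apply: (intertwines_chain (th := fun=> th)) => [i1 i2|i1].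
    exact/fps_commP/shC.
  have := intertwines_shift (sh k s i1.+1) (A_other s (th - sh k s i1.+1) sj).
  by rewrite subrK.
have P_same k : k != j ->
    intertwines b E n (P k j) (c k j) (- c k j) (fun r => dl j r *+ absz (- a j k)).
  (* Consecutive shifts differ by [c j j], exactly the change of parameter made by [A_j], so the
     factors of [P k j] telescope. *)
  move=> kj; have shE i1 : sh k j i1 = c k j + c j j *+ i1.
    rewrite /sh /kap intrD intrM -pmulrn -[_ *+ i1]mulr_natl; ring.
  have := @intertwines_chain _ _ b E n (fun i1 => fps_shift (sh k j i1) (gen1 (A j)))
    (sh k j) (dl j) (absz (- a j k)).
  have -> : sh k j 0 = c k j by rewrite shE addr0.
  (* The chain ends at [c k j - a_jk c_jj], and [a_jk c_jj = 2 c_kj] by symmetry and [a j j = 2];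
     this is the final parameter of [H_k]. *)
  have -> : sh k j (absz (- a j k)) = - c k j.
    rewrite /sh /kap -mulrN -rmorphN /=; congr (_ * _%:~R).
    rewrite gez0_abs ?oppr_ge0 ?a_off // 1?eq_sym //.
    by rewrite /rform a_diag d_sym; ring.
  apply=> [i1 i2|i1]; first exact/fps_commP/shC.
  have := intertwines_shift (sh k j i1.+1) A_same; rewrite add0r.
  have -> // : - c j j + sh k j i1.+1 = sh k j i1.
  by rewrite !shE mulrSr; ring.
apply: (a_ker (x := fun s => dl s r)) => k.
have rhs t t' : (k != j -> t = c k j /\ t' = - c k j) ->
    (k = j -> t = t') ->
    intertwines b E n (gen1 (A k) * (gen1 (H k) * fps_shift (c k k) (gen1 (A k))))
     t t' (fun r => \sum_(s <- index_enum 'I_l | s != k) dl s r *+ absz (- a s k)).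
  move=> Ht Ht'; rewrite fact; have := @intertwines_prod _ _ b E n _ (index_enum 'I_l)
    (fun s => s != k) j (P k) t t' (fun s r => dl s r *+ absz (- a s k)).
  rewrite mem_index_enum index_enum_uniq /=.
  have -> : (if j != k then t' else t) = t' by case: eqP => // /esym /Ht' ->.
  apply=> // [s _ sj th|jk]; first exact: P_other.
  by case: Ht => [|-> ->]; rewrite 1?eq_sym //; apply: P_same; rewrite eq_sym.
have lhsC :
    bmul b (gen1 (A k)) (bmul b (gen1 (H k)) (fps_shift (c k k) (gen1 (A k)))) =
    gen1 (A k) * (gen1 (H k) * fps_shift (c k k) (gen1 (A k))).
  have AsH : gen1 (H k) * fps_shift (c k k) (gen1 (A k)) =
      fps_shift (c k k) (gen1 (A k)) * gen1 (H k).
    by apply/esym/fps_commP/coef_comm_shift.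
  rewrite (bmul_comm b AsH) bmul_comm // mulrA (fps_commP (AH_comm k k)) -!mulrA.
  congr (_ * _).
  by apply/esym/fps_commP/coef_comm_shift.
(* On the left each of the two factors [A_k] contributes [dl k r] and [H_k] nothing; on the right
   [A_s] occurs [- a s k] times. *)
have eqk : dl k r *+ 2 = \sum_(s | s != k) dl s r *+ absz (- a s k).
  case: (eqVneq k j) => [kj|kj].
    have := intertwines_mul (intertwines_shift (c j j) A_same)
      (t3 := - c j j) (X := gen1 (H j)) (dl' := fun=> 0).
    rewrite addNr add0r => /(_ (HE_intertwines n j)) H1.
    have := intertwines_mul H1 A_same; rewrite -kj lhsC => -[_ /(_ r) H2].
    have [||_ /(_ r) H3] := rhs 0 0; [by rewrite kj eqxx | by [] |].
    by have := leading_inj H2 H3; rewrite addr0 -mulr2n.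
  have H0 := intertwines_shift (c k k) (A_other k (c k j - c k k) kj).
  rewrite subrK in H0.
  have := intertwines_mul (intertwines_mul H0 (HE_intertwines n k)) (A_other k _ kj).
  rewrite lhsC => -[_ /(_ r) H2].
  have [//||_ /(_ r) H3] := rhs (c k j) (- c k j).
    by move/eqP; rewrite (negPf kj).
  by have := leading_inj H2 H3; rewrite addr0 -mulr2n.
rewrite (bigD1 k) //= a_diag scaler_int -[_ *~ 2]/(_ *+ 2) eqk -big_split.
rewrite big1 //= => s sk.
by rewrite scaler_int pmulrn gez0_abs ?oppr_ge0 ?a_off // mulrNz addNr.
Qed.

End CurrentsOfA.

(** * Series in two variables *)

Lemma acomm_subC (S : nzRingType) (x y z : S) : acomm x (y - z) = - acomm x (z - y).
Proof. by rewrite /acomm -(opprB z) mulrN mulNr -opprD. Qed.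

Section TwoVariables.
Variable S : nzRingType.
Implicit Types (f g : fps S) (Z W : fps (fps S)).

Local Notation x := (fps_uinv S).
Local Notation dl := (in_v x - in_u x).
Local Notation p := (in_u x * in_v x).

(* The coefficient of v^-n, as a series in u. *)
Definition vcoef n Z : fps S := fun m => Z m n.

Lemma vcoefP Z W : (forall n, vcoef n Z = vcoef n W) -> Z = W.
Proof.
move=> ZW; apply/funext => m; apply/funext => n.
exact: (congr1 (fun f : fps S => f m) (ZW n)).
Qed.

Lemma vcoefB n Z W : vcoef n (Z - W) = vcoef n Z - vcoef n W. Proof. by []. Qed.
Lemma vcoefD n Z W : vcoef n (Z + W) = vcoef n Z + vcoef n W. Proof. by []. Qed.
Lemma vcoef0 n : vcoef n 0 = 0. Proof. by []. Qed.

Lemma vcoef_lcomm n Z W : vcoef n (lcomm Z W) = vcoef n (Z * W) - vcoef n (W * Z).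
Proof. by []. Qed.

Lemma vcoef_acomm n Z W : vcoef n (acomm Z W) = vcoef n (Z * W) + vcoef n (W * Z).
Proof. by []. Qed.

Lemma vcoef_uM n f Z : vcoef n (in_u f * Z) = f * vcoef n Z.
Proof.
apply/funext => m; rewrite /vcoef fps_coefM fps_coef_sum; apply: eq_bigr => i _.
exact: fps_coef_constM.
Qed.

Lemma vcoef_Mu n f Z : vcoef n (Z * in_u f) = vcoef n Z * f.
Proof.
apply/funext => m; rewrite /vcoef fps_coefM fps_coef_sum; apply: eq_bigr => i _.
exact: fps_coefMconst.
Qed.

Lemma vcoef_v n f : vcoef n (in_v f) = fps_const (f n).
Proof. by apply/funext => -[|m]. Qed.

Lemma vcoef_u0 f : vcoef 0 (in_u f) = f. Proof. by apply/funext. Qed.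
Lemma vcoef_uS n f : vcoef n.+1 (in_u f) = 0. Proof. by apply/funext. Qed.

Lemma vcoef_vinv0 Z : vcoef 0 (in_v x * Z) = 0.
Proof. by apply/funext => m; rewrite /vcoef fps_coef_constM fps_coef_uinv0. Qed.

Lemma vcoef_vinvS n Z : vcoef n.+1 (in_v x * Z) = vcoef n Z.
Proof. by apply/funext => m; rewrite /vcoef fps_coef_constM fps_coef_uinvS. Qed.

Lemma fps_uinvI f : x * f = 0 -> f = 0.
Proof.
move=> xf; apply/funext => n; have := congr1 (fun g : fps S => g n.+1) xf.
by rewrite fps_coef_uinvS.
Qed.

Lemma umvP Z W : umv_mul_eq Z W <-> vcoef 0 Z = 0 /\
  forall n, vcoef n Z - x * vcoef n.+1 Z = x * vcoef n W.
Proof.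
rewrite /umv_mul_eq -mulrA mulrBl; split=> [ZW|[Z0 ZW]]; last first.
  apply: vcoefP => -[|n]; rewrite vcoefB !vcoef_uM ?vcoef_vinv0 ?vcoef_vinvS.
    by rewrite Z0 mulr0 subrr.
  exact: ZW.
split=> [|n].
  have := congr1 (vcoef 0) ZW; rewrite vcoefB !vcoef_uM !vcoef_vinv0 sub0r mulr0.
  by move/eqP; rewrite oppr_eq0 => /eqP /fps_uinvI.
by have := congr1 (vcoef n.+1) ZW; rewrite vcoefB !vcoef_uM !vcoef_vinvS.
Qed.

(** The coefficients in [v^-1] vanish one after the other, since each is multiplied by the
    cancellable [u^-1] in the next equation. *)
Lemma umv_inj Z : dl * Z = 0 -> Z = 0.
Proof.
move=> dlZ; have /umvP[Z0 ZS] : umv_mul_eq Z 0 by rewrite /umv_mul_eq dlZ mulr0.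
apply: vcoefP; elim=> [//|n IHn]; apply: fps_uinvI.
have := ZS n; rewrite IHn vcoef0 sub0r mulr0 => /eqP.
by rewrite oppr_eq0 => /eqP.
Qed.

Lemma in_uM f g : in_u (f * g) = in_u f * in_u g.
Proof.
by apply: vcoefP => -[|n]; rewrite vcoef_uM ?vcoef_uS ?mulr0 // !vcoef_u0.
Qed.

Lemma in_uD f g : in_u (f + g) = in_u f + in_u g.
Proof.
by apply: vcoefP => -[|n]; rewrite vcoefD ?vcoef_uS ?addr0 // !vcoef_u0.
Qed.

Lemma in_vM f g : in_v (f * g) = in_v f * in_v g. Proof. exact: rmorphM. Qed.
Lemma in_vD f g : in_v (f + g) = in_v f + in_v g. Proof. exact: rmorphD. Qed.

Lemma in_uinvC Z : in_u x * Z = Z * in_u x.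
Proof. by apply: vcoefP => n; rewrite vcoef_uM vcoef_Mu fps_uinvC. Qed.

Lemma in_vinvC Z : in_v x * Z = Z * in_v x.
Proof.
by apply/funext => m; rewrite fps_coef_constM fps_coefMconst fps_uinvC.
Qed.

Lemma umvC Z : dl * Z = Z * dl.
Proof. by rewrite mulrBl mulrBr in_uinvC in_vinvC. Qed.

Lemma uvinvC Z : p * Z = Z * p.
Proof. by rewrite -mulrA in_vinvC mulrA in_uinvC mulrA. Qed.

Lemma in_uv_comm f g : coef_comm f g -> in_u f * in_v g = in_v g * in_u f.
Proof.
move=> fg; apply: vcoefP => n; rewrite vcoef_uM vcoef_Mu vcoef_v.
by apply/funext => m; rewrite fps_coefMconst fps_coef_constM fg.
Qed.

(** Several pairs of fields of [current_relations] come from one relation by exchanging [u] and [v],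
    which negates [u - v]. *)
Definition swap_uv Z : fps (fps S) := fun m n => Z n m.

Lemma swap_uvM Z W : swap_uv (Z * W) = swap_uv Z * swap_uv W.
Proof.
apply/funext => m; apply/funext => n; rewrite /swap_uv fps_coefM fps_coef_sum.
rewrite fps_coefM fps_coef_sum; under eq_bigr do rewrite fps_coefM.
by rewrite exchange_big; apply: eq_bigr => i _; rewrite fps_coefM.
Qed.

Lemma swap_lcomm Z W : swap_uv (lcomm Z W) = lcomm (swap_uv Z) (swap_uv W).
Proof. by rewrite -[LHS]/(swap_uv (Z * W) - swap_uv (W * Z)) !swap_uvM. Qed.

Lemma swap_acomm Z W : swap_uv (acomm Z W) = acomm (swap_uv Z) (swap_uv W).
Proof. by rewrite -[LHS]/(swap_uv (Z * W) + swap_uv (W * Z)) !swap_uvM. Qed.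

Lemma swap_uvB Z W : swap_uv (Z - W) = swap_uv Z - swap_uv W. Proof. by []. Qed.
Lemma swap_u f : swap_uv (in_u f) = in_v f.
Proof. by apply/funext => -[|m]; apply/funext => n. Qed.
Lemma swap_v f : swap_uv (in_v f) = in_u f.
Proof. by apply/funext => m; apply/funext => -[|n]. Qed.

Lemma umv_swap Z W : umv_mul_eq Z W -> umv_mul_eq (swap_uv Z) (- swap_uv W).
Proof.
move/(congr1 swap_uv); rewrite !swap_uvM swap_uvB !(swap_u, swap_v) => E.
by rewrite /umv_mul_eq -[in_v x - in_u x]opprB mulNr E in_vinvC mulrN.
Qed.

(** The expansion of [(f(u) - f(v)) / (u - v)]: for [u^-k] the quotient is minus the sum of all
    [u^-m v^-n] with [m, n >= 1] and [m + n = k + 1]. *)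
Definition divided_difference f : fps (fps S) :=
  fun m n => if (m == 0) || (n == 0) then 0 else - f (m + n).-1.

Lemma divided_differenceP f : umv_mul_eq (divided_difference f) (in_u f - in_v f).
Proof.
apply/umvP; split=> [|n].
  by apply/funext => m; rewrite /vcoef /divided_difference orbT.
rewrite vcoefB vcoef_v; case: n => [|n].
  rewrite vcoef_u0; apply/funext => -[|m].
    by rewrite fps_coefB !fps_coef_uinv0 subrr.
  rewrite fps_coefB !fps_coef_uinvS /vcoef /divided_difference /= sub0r fps_coefB.
  case: m => [|m] /=; first by rewrite -[fps_const _ _]/(f 0%N) subrr oppr0.
  by rewrite -[fps_const _ _]/(0 : S) subr0 opprK addn1.
rewrite vcoef_uS sub0r; apply/funext => -[|m].
  by rewrite fps_coefB !fps_coef_uinv0 subrr.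
rewrite fps_coefB !fps_coef_uinvS /vcoef /divided_difference /= fps_coefN /fps_const.
case: m => [|m] /=; first by rewrite subr0.
by rewrite addSnnS subrr oppr0.
Qed.

End TwoVariables.

Section TwoVariablesAlgebra.
Variables (K : nzRingType) (S : algType K).
Implicit Types (f g : fps S) (Z W : fps (fps S)).

Lemma vcoefZ n (c : K) Z : vcoef n (c *: Z) = c *: vcoef n Z. Proof. by []. Qed.
Lemma swap_uvZ (c : K) Z : swap_uv (c *: Z) = c *: swap_uv Z. Proof. by []. Qed.

Lemma in_uZ (c : K) f : in_u (c *: f) = c *: in_u f.
Proof.
by apply: vcoefP => -[|n]; rewrite vcoefZ ?vcoef_uS ?scaler0 // !vcoef_u0.
Qed.

Lemma in_vZ (c : K) f : in_v (c *: f) = c *: in_v f.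
Proof.
by apply/funext => -[|n]; rewrite // fps_coefZ -[RHS]/(c *: 0) scaler0.
Qed.

Local Notation x := (fps_uinv S).
Local Notation dl := (in_v x - in_u x).
Local Notation p := (in_u x * in_v x).

Lemma umvZ (k : K) Z W : umv_mul_eq Z (k *: W) -> dl * Z = k *: p * W.
Proof. by move=> ->; rewrite -scalerAr scalerAl. Qed.

Lemma umvZN (k : K) Z W : umv_mul_eq Z (- k *: W) -> dl * Z = - (k *: p) * W.
Proof. by move/umvZ => ->; rewrite scaleNr. Qed.

Lemma umvZ_swap (k : K) Z W :
  umv_mul_eq Z (k *: W) -> dl * swap_uv Z = - (k *: p) * swap_uv W.
Proof. by move/umv_swap; rewrite swap_uvZ -scaleNr => /umvZN. Qed.

Lemma umvZN_swap (k : K) Z W :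
  umv_mul_eq Z (- k *: W) -> dl * swap_uv Z = k *: p * swap_uv W.
Proof. by move/umvZ_swap; rewrite scaleNr opprK. Qed.

Lemma divided_differenceZ (k : K) f :
  dl * (k *: divided_difference f) = k *: p * (in_u f - in_v f).
Proof. by rewrite -scalerAr (divided_differenceP f) scalerAl. Qed.

Lemma uvinvZC (k : K) Z : Z * (k *: p) = k *: p * Z.
Proof. by rewrite -scalerAr -scalerAl uvinvC. Qed.

End TwoVariablesAlgebra.

Lemma sub_mul_solve (S : pzRingType) (x p q s t y z : S) :
  p - q - x * (s - t) = x * (y + z) -> p - x * (s + y) = q - x * (t - z).
Proof.
by move=> E; apply/subr0_eq; rewrite -(subrr (x * (y + z))) -{1}E; ncring.
Qed.

Lemma sub_mul_regroup (S : pzRingType) (x p q s t y : S) :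
  p - x * (s - y) = q - x * t -> p - q - x * (s - t) = x * - y.
Proof.
by move=> E; apply/subr0_eq; rewrite -(subrr (q - x * t)) -{1}E; ncring.
Qed.

Lemma add_mul_regroup (S : pzRingType) (x p q y z : S) :
  p - x * q = x * - y -> p + x * (y + z) = x * (q + z).
Proof.
by move=> E; apply/subr0_eq; rewrite -(subrr (x * - y)) -{1}E; ncring.
Qed.

(** * Passage between modes and generating series *)

Section CurrentRelations.
Variables (K : nzRingType) (S : algType K) (c : K).
Implicit Types (f g X : fps S) (E : nat -> S).
Local Notation x := (fps_uinv S).

Lemma lam_of_HE X E :
  umv_mul_eq (lcomm (in_u X) (in_v (gen0 E)))
    (- c *: acomm (in_u X) (in_u (gen0 E) - in_v (gen0 E))) ->
  forall r, bmul true X (lam c (currents E) r) =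
    bmul true (lam (- c) (currents E) r) X.
Proof.
(* The mode [E r] sits at [v^-(r+1)]; at this positive order the summand [E(u)] of the right-hand
   side does not contribute. *)
case/umvP=> _ ZW r; have := ZW r.+1.
rewrite vcoefZ !vcoef_lcomm vcoef_acomm !vcoef_uM !vcoef_Mu !vcoefB !vcoef_v.
rewrite vcoef_uS.
rewrite sub0r -[fps_const (gen0 E r.+1)]/(currents E r)
  -[fps_const (gen0 E r.+2)]/(currents E r.+1).
rewrite bmul_lamr bmul_laml /lam /= mulrN mulNr -opprD scaleNr scalerN opprK.
by rewrite scalerDr scaleNr => /sub_mul_solve.
Qed.

Lemma lam_of_HF X E :
  umv_mul_eq (lcomm (in_u X) (in_v (gen0 E)))
    (c *: acomm (in_u X) (in_u (gen0 E) - in_v (gen0 E))) ->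
  forall r, bmul false X (lam c (currents E) r) =
    bmul false (lam (- c) (currents E) r) X.
Proof.
case/umvP=> _ ZW r; have := ZW r.+1.
rewrite vcoefZ !vcoef_lcomm vcoef_acomm !vcoef_uM !vcoef_Mu !vcoefB !vcoef_v.
rewrite vcoef_uS.
rewrite sub0r -[fps_const (gen0 E r.+1)]/(currents E r)
  -[fps_const (gen0 E r.+2)]/(currents E r.+1).
rewrite bmul_lamr bmul_laml /lam /= mulrN mulNr.
by rewrite scalerDr scaleNr !scalerN => /sub_mul_solve ->; rewrite opprK.
Qed.

Variables (b : bool) (X : fps S) (E : nat -> S).
Hypothesis lamX : forall r,
  bmul b X (lam (- c) (currents E) r) = bmul b (lam 0 (currents E) r) X.

Let G r := bmul b X (currents E r) - bmul b (currents E r) X.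

Lemma lamX_rec r :
  G r - x * G r.+1 = x * (c *: - bmul b X (currents E r)).
Proof.
have := lamX r; rewrite bmul_lamr bmul_laml /lam scale0r addr0 scaleNr.
by rewrite scalerN => /sub_mul_regroup.
Qed.

(** This is the coefficient at [v^0], the only one containing all of [E(u)]. The tails [T r] solve
    the recursion of [lamX_rec] up to the factor [- c X]; the difference [D r] of the two solutions
    is divisible by every power of [u^-1], hence 0. *)
Lemma lamX_bottom : - G 0 = c *: bmul b X (gen0 E).
Proof.
pose T r := gen0 (fun s => E (r + s)%N).
have TS r : T r = x * (currents E r + T r.+1).
  apply/funext => -[|n]; first by rewrite fps_coef_uinv0.
  rewrite fps_coef_uinvS fps_coefD /T /currents /=.
  by case: n => [|n] /=; rewrite ?addn0 ?addr0 ?add0r ?addnS.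
pose D r := G r + c *: bmul b X (T r).
have DS r : D r = x * D r.+1.
  rewrite /D {1}TS bmulCr; last exact: fps_uinvC.
  rewrite bmulDr scalerAr scalerDr; apply: add_mul_regroup.
  by rewrite lamX_rec scalerN.
have D0 n r : D r n = 0.
  elim: n r => [|n IHn] r; rewrite DS ?fps_coef_uinv0 ?fps_coef_uinvS //.
have : D 0 = 0 by apply/funext.
by move/eqP; rewrite addr_eq0 => /eqP ->; rewrite opprK.
Qed.

End CurrentRelations.

Lemma umv_of_lamE (K : nzRingType) (S : algType K) (c : K) (X : fps S) (E : nat -> S) :
  (forall r, bmul true X (lam (- c) (currents E) r)
           = bmul true (lam 0 (currents E) r) X) ->
  umv_mul_eq (lcomm (in_u X) (in_v (gen0 E)))
    (c *: (in_u X * (in_u (gen0 E) - in_v (gen0 E)))).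
Proof.
move=> lamX; apply/umvP; rewrite vcoef_lcomm vcoef_uM vcoef_Mu vcoef_v.
rewrite raddf0 mulr0 mul0r subrr; split=> // -[|n].
  rewrite !vcoef_lcomm vcoefZ !vcoef_uM !vcoef_Mu vcoefB !vcoef_v vcoef_u0.
  rewrite -[gen0 E 0]/(0 : S) !raddf0 mulr0 mul0r ?subr0 addr0 sub0r.
  by rewrite -mulrN; congr (_ * _); exact: (lamX_bottom lamX).
rewrite !vcoef_lcomm vcoefZ !vcoef_uM !vcoef_Mu vcoefB !vcoef_v vcoef_uS sub0r.
rewrite mulrN.
exact: lamX_rec lamX n.
Qed.

Lemma umv_of_lamF (K : nzRingType) (S : algType K) (c : K) (X : fps S) (E : nat -> S) :
  (forall r, bmul false X (lam (- c) (currents E) r)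
           = bmul false (lam 0 (currents E) r) X) ->
  umv_mul_eq (lcomm (in_v (gen0 E)) (in_u X))
    (c *: ((in_u (gen0 E) - in_v (gen0 E)) * in_u X)).
Proof.
move=> lamX; apply/umvP; rewrite vcoef_lcomm vcoef_uM vcoef_Mu vcoef_v.
rewrite raddf0 mulr0 mul0r subrr; split=> // -[|n].
  rewrite !vcoef_lcomm vcoefZ !vcoef_uM !vcoef_Mu vcoefB !vcoef_v vcoef_u0.
  rewrite -[gen0 E 0]/(0 : S) !raddf0 mulr0 mul0r ?subr0 addr0 sub0r.
  by rewrite -mulrN; congr (_ * _); exact: (lamX_bottom lamX).
rewrite !vcoef_lcomm vcoefZ !vcoef_uM !vcoef_Mu vcoefB !vcoef_v vcoef_uS sub0r.
rewrite mulNr.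
exact: lamX_rec lamX n.
Qed.

(** * The relations of the Yangian *)

Section Centralizer.
Variables (K : numClosedFieldType) (l : nat) (Y : algType K).
Implicit Types X Z : 'I_l -> nat -> Y.

Lemma subalg_closed_centralizer Z :
  subalg_closed [pred y : Y | `[< forall j s, y * Z j s = Z j s * y >]].
Proof.
split=> [|c x y|x y]; rewrite !inE.
- by apply/asboolP => j s; rewrite mul1r mulr1.
- move=> /asboolP xZ /asboolP yZ; apply/asboolP => j s.
  by rewrite mulrDl mulrDr -scalerAl -scalerAr xZ yZ.
move=> /asboolP xZ /asboolP yZ; apply/asboolP => j s.
by rewrite -mulrA yZ mulrA xZ mulrA.
Qed.

(** The centralizer of the [Z j t] is a subalgebra containing all [H i s], hence all [A i s]. *)
Lemma coefs_in_H_comm (H A Z : 'I_l -> nat -> Y) : coefs_in_H_subalgebra H A ->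
  (forall i s j t, H i s * Z j t = Z j t * H i s) ->
  forall i s j t, A i s * Z j t = Z j t * A i s.
Proof.
move=> A_H HZ i s; have := A_H _ (subalg_closed_centralizer Z) _ i s.
rewrite inE => AZ; apply/asboolP/AZ => k r; rewrite inE; apply/asboolP; exact: HZ.
Qed.

Lemma gen0_coef_comm (X Z : nat -> Y) :
  (forall s t, X s * Z t = Z t * X s) -> coef_comm (gen0 X) (gen0 Z).
Proof. by move=> XZ [|m] [|n] /=; rewrite ?mul0r ?mulr0. Qed.

Lemma gen1S (X : nat -> Y) n : gen1 X n.+1 = X n.
Proof. by rewrite /gen1 fps_coefD add0r. Qed.

Lemma gen1_coef_comm (X : nat -> Y) (f : fps Y) :
  (forall s t, X s * f t = f t * X s) -> coef_comm (gen1 X) f.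
Proof. by move=> Xf [|m] n; rewrite ?gen1_0 ?mul1r ?mulr1 // gen1S. Qed.

Lemma lcomm0_coef_comm (f g : fps Y) :
  lcomm (in_u f) (in_v g) = 0 -> coef_comm f g.
Proof.
move=> fg m n; have := congr1 (vcoef n) fg.
rewrite vcoef_lcomm vcoef_uM vcoef_Mu !vcoef_v => /(congr1 (fun h : fps Y => h m)).
rewrite fps_coefB fps_coefMconst fps_coef_constM => /eqP.
by rewrite subr_eq0 => /eqP.
Qed.

End Centralizer.

Lemma lcomm_eq0 (S : pzRingType) (x y : S) : GRing.comm x y -> x * y - y * x = 0.
Proof. by move=> ->; rewrite subrr. Qed.

Section FromUmv.
Variables (K : nzRingType) (S : algType K) (a h e f : fps S) (c q : K) (n : nat).
Hypothesis cE : c = n%:R * q.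
Hypothesis aaC : coef_comm a a.
Hypothesis ahC : coef_comm a h.
Hypothesis umv_ae : umv_mul_eq (lcomm (in_u a) (in_v e))
  (c *: (in_u a * (in_u e - in_v e))).
Hypothesis umv_af : umv_mul_eq (lcomm (in_v f) (in_u a))
  (c *: ((in_u f - in_v f) * in_u a)).
Hypothesis umv_ee : umv_mul_eq (lcomm (in_u e) (in_v e))
  (- c *: (in_u e - in_v e) ^+ 2).
Hypothesis umv_ff : umv_mul_eq (lcomm (in_u f) (in_v f))
  (c *: (in_u f - in_v f) ^+ 2).
Hypothesis umv_ef : umv_mul_eq (lcomm (in_u e) (in_v f))
  (- q *: (in_u h - in_v h)).
Hypothesis umv_he : umv_mul_eq (lcomm (in_u h) (in_v e))
  (- c *: acomm (in_u h) (in_u e - in_v e)).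
Hypothesis umv_hf : umv_mul_eq (lcomm (in_u h) (in_v f))
  (c *: acomm (in_u h) (in_u f - in_v f)).

Local Notation x := (fps_uinv S).
Local Notation dl := (in_v x - in_u x).
Local Notation p := (in_u x * in_v x).

Lemma umv_current_relations : current_relations dl (c *: p) (q *: p) n%:R
  (in_u a) (in_v a) (in_u h) (in_v h) (in_u e) (in_v e) (in_u f) (in_v f)
  (c *: divided_difference e) (c *: divided_difference f)
  (- q *: divided_difference h).
Proof.
split.
- by move=> z; rewrite umvC.
- exact: uvinvZC.
- exact: uvinvZC.
- by move=> z; rewrite mulr_natl mulr_natr.
- exact: umv_inj.
- by rewrite mulr_natl -scaler_nat scalerA cE.
- exact: divided_differenceZ.
- exact: divided_differenceZ.
- by rewrite divided_differenceZ scaleNr mulNr -mulrN opprB.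
- exact/in_uv_comm.
- by rewrite -!in_uM; congr in_u; apply/fps_commP.
- exact/in_uv_comm.
- exact/esym/in_uv_comm/coef_comm_sym.
- by rewrite -!in_vM; congr in_v; apply/fps_commP.
- exact: umvZ umv_ae.
- have := umvZ_swap umv_ae.
  rewrite swap_lcomm swap_uvM swap_uvB !(swap_u, swap_v) mulNr -mulrN -mulrN opprB.
  exact.
- exact: umvZ umv_af.
- have := umvZ_swap umv_af.
  rewrite swap_lcomm swap_uvM swap_uvB !(swap_u, swap_v) mulNr -mulrN -mulNr opprB.
  exact.
- exact: umvZN umv_ee.
- exact: umvZ umv_ff.
- have := umvZN umv_ef.
  rewrite mulNr -mulrN opprB; exact.
- have := umvZN_swap umv_ef.
  rewrite swap_lcomm swap_uvB !(swap_u, swap_v); exact.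
- have := umvZN_swap umv_he.
  rewrite swap_lcomm swap_acomm swap_uvB !(swap_u, swap_v).
  rewrite acomm_subC mulrN -mulNr; exact.
- exact: umvZN umv_he.
- have := umvZ_swap umv_hf.
  rewrite swap_lcomm swap_acomm swap_uvB !(swap_u, swap_v).
  rewrite acomm_subC mulrNN; exact.
- exact: umvZ umv_hf.
Qed.

End FromUmv.

Section GL2.
Variables (K : numClosedFieldType) (l : nat) (a : 'M[int]_l) (d : 'I_l -> nat).
Variables (hbar : K) (Y : algType K) (H E F A : 'I_l -> nat -> Y).
Hypothesis a_ker : forall x : 'I_l -> Y,
  (forall i, \sum_s (a s i)%:~R *: x s = 0) -> forall s, x s = 0.
Hypothesis a_diag : forall i, a i i = 2.
Hypothesis a_off : forall i j, i != j -> a i j <= 0.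
Hypothesis d_sym : forall i j, (d i)%:Z * a i j = (d j)%:Z * a j i.
Hypothesis Y_rel : yangian_rel a d hbar H E F.
Hypothesis A_coefs : coefs_in_H_subalgebra H A.
Hypothesis A_fact : H_factorisation a d hbar H A.

Local Notation c := (kap a d hbar).
Local Notation ihd i := ('i * hbar * (d i)%:R).

Lemma kap_diag i : c i i = ihd i.
Proof.
by rewrite /kap /rform a_diag intrM -pmulrn; field.
Qed.

Lemma HH_comm i s j t : H i s * H j t = H j t * H i s.
Proof.
have /lcomm0_coef_comm := yHH Y_rel i j => /(_ s.+1 t.+1).
by rewrite !gen1S.
Qed.

Lemma AH_comm i s j t : A i s * H j t = H j t * A i s.
Proof. exact: coefs_in_H_comm A_coefs HH_comm i s j t. Qed.

Lemma AA_comm i s j t : A i s * A j t = A j t * A i s.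
Proof. by apply: coefs_in_H_comm A_coefs _ i s j t => *; rewrite AH_comm. Qed.

Lemma AA_coef_comm i j : coef_comm (gen1 (A i)) (gen1 (A j)).
Proof.
apply: gen1_coef_comm => s [|t]; rewrite ?gen1_0 ?mulr1 ?mul1r // gen1S.
exact: AA_comm.
Qed.

Lemma AH_coef_comm i j : coef_comm (gen1 (A i)) (gen1 (H j)).
Proof.
apply: gen1_coef_comm => s [|t]; rewrite ?gen1_0 ?mulr1 ?mul1r // gen1S.
exact: AH_comm.
Qed.

Lemma A_defectE_eq0 j i r : A_defect a d hbar A true j (E j) i r = 0.
Proof.
apply: (A_defect_eq0 a_ker a_diag a_off d_sym AA_coef_comm AH_coef_comm A_fact).
by move=> k; exact: (lam_of_HE (yHE Y_rel k j)).
Qed.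

Lemma A_defectF_eq0 j i r : A_defect a d hbar A false j (F j) i r = 0.
Proof.
apply: (A_defect_eq0 a_ker a_diag a_off d_sym AA_coef_comm AH_coef_comm A_fact).
by move=> k; exact: (lam_of_HF (yHF Y_rel k j)).
Qed.

Lemma AE_coef_comm i j : i != j -> coef_comm (gen1 (A i)) (gen0 (E j)).
Proof.
move=> ij m [|r]; first by rewrite mulr0 mul0r.
have := A_defectE_eq0 j i r; rewrite /A_defect (negPf ij) /=.
move=> /(congr1 (fun f : fps Y => f m)).
rewrite fps_coefB fps_coefMconst fps_coef_constM => /eqP.
by rewrite subr_eq0 => /eqP.
Qed.

Lemma AF_coef_comm i j : i != j -> coef_comm (gen1 (A i)) (gen0 (F j)).
Proof.
move=> ij m [|r]; first by rewrite mulr0 mul0r.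
have := A_defectF_eq0 j i r; rewrite /A_defect (negPf ij) /=.
move=> /(congr1 (fun f : fps Y => f m)).
rewrite fps_coefB fps_coefMconst fps_coef_constM => /eqP.
by rewrite subr_eq0 => /eqP.
Qed.

Lemma EF_comm i j : i != j -> in_u (gen0 (E i)) * in_v (gen0 (F j)) =
  in_v (gen0 (F j)) * in_u (gen0 (E i)).
Proof.
move=> ij; apply/subr0_eq/umv_inj; have := yEF Y_rel i j.
by rewrite /= (negPf ij) mulr0 oppr0 scale0r /umv_mul_eq mulr0.
Qed.

(** When [a i j = 0] the Serre sum has a single permutation and a single bracket, so it expresses
    that the currents commute. *)
Lemma serre_coef1 (X : nat -> Y) z (n : nat) (s : 'I_n -> nat) (i : 'I_n) :
  n = 1 -> serre_coef X z s = lcomm (X (s i)) z.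
Proof.
move=> n1; subst n; rewrite /serre_coef (eq_bigr (fun=> lcomm (X (s i)) z)).
  by rewrite sumr_const card_Sn.
by move=> sg _; rewrite enum_ordSl enum_ord0 /= (ord1 (sg _)) (ord1 i).
Qed.

Lemma EE_coef_comm i j : a i j = 0 -> i != j -> coef_comm (gen0 (E i)) (gen0 (E j)).
Proof.
move=> aij ij; apply: gen0_coef_comm => s t.
have := ySerreE Y_rel ij; rewrite aij subr0 => /(_ (fun=> s) t).
by rewrite (serre_coef1 _ _ _ ord0) // => /subr0_eq.
Qed.

Lemma FF_coef_comm i j : a i j = 0 -> i != j -> coef_comm (gen0 (F i)) (gen0 (F j)).
Proof.
move=> aij ij; apply: gen0_coef_comm => s t.
have := ySerreF Y_rel ij; rewrite aij subr0 => /(_ (fun=> s) t).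
by rewrite (serre_coef1 _ _ _ ord0) // => /subr0_eq.
Qed.

Lemma umv_AE i : umv_mul_eq (lcomm (in_u (gen1 (A i))) (in_v (gen0 (E i))))
  (c i i *: (in_u (gen1 (A i)) * (in_u (gen0 (E i)) - in_v (gen0 (E i))))).
Proof.
apply: umv_of_lamE => r; have := A_defectE_eq0 i i r.
by rewrite /A_defect eqxx => /subr0_eq.
Qed.

Lemma umv_AF i : umv_mul_eq (lcomm (in_v (gen0 (F i))) (in_u (gen1 (A i))))
  (c i i *: ((in_u (gen0 (F i)) - in_v (gen0 (F i))) * in_u (gen1 (A i)))).
Proof.
apply: umv_of_lamF => r; have := A_defectF_eq0 i i r.
by rewrite /A_defect eqxx => /subr0_eq.
Qed.

Lemma yangian_current_relations i : current_relations
  (in_v (fps_uinv Y) - in_u (fps_uinv Y))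
  (c i i *: (in_u (fps_uinv Y) * in_v (fps_uinv Y)))
  (('i * hbar) *: (in_u (fps_uinv Y) * in_v (fps_uinv Y))) (d i)%:R
  (in_u (gen1 (A i))) (in_v (gen1 (A i))) (in_u (gen1 (H i))) (in_v (gen1 (H i)))
  (in_u (gen0 (E i))) (in_v (gen0 (E i))) (in_u (gen0 (F i))) (in_v (gen0 (F i)))
  (c i i *: divided_difference (gen0 (E i)))
  (c i i *: divided_difference (gen0 (F i)))
  (- ('i * hbar) *: divided_difference (gen1 (H i))).
Proof.
have yEFii := yEF Y_rel i i; rewrite /= eqxx mulr1 in yEFii.
exact: (umv_current_relations (etrans (kap_diag i) (mulrC _ _)) (AA_coef_comm i i)
  (AH_coef_comm i i) (umv_AE i) (umv_AF i) (yEE Y_rel i) (yFF Y_rel i) yEFii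
  (yHE Y_rel i i) (yHF Y_rel i i)).
Qed.

End GL2.

(** * The series A, B, C, D *)

Section RescaledRelations.
Variables (K : comNzRingType) (T : algType K) (dl p : T) (c q s : K) (n : nat).
Variables (a b h h' e e' f f' eps phi eta : T).
Hypothesis rel : current_relations dl (c *: p) (q *: p) n%:R
  a b h h' e e' f f' eps phi eta.
Hypothesis s2 : s * s = n%:R.

Variables (B B' C C' D D' : T).
Hypotheses (BE : B = s *: (a * e)) (B'E : B' = s *: (b * e')).
Hypotheses (CE : C = s *: (f * a)) (C'E : C' = s *: (f' * b)).
Hypothesis DE : D = a * h + n%:R * (f * a * e).
Hypothesis D'E : D' = b * h' + n%:R * (f' * b * e').

Let scale_rel (k : K) Z W :
  dl * Z = c *: p * W -> dl * (k *: Z) = p * (c *: (k *: W)).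
Proof. by move=> E; rewrite -scalerAr E -!scalerAl -!scalerAr !scalerA mulrC. Qed.

(** Relations linear in [B] or [C] acquire [s] on both sides; in the quadratic products [s * s = n]
    appears, which is the factor [n] in [D]. *)
Let mulZZ x y : (s *: x) * (s *: y) = n%:R * (x * y) :> T.
Proof. by rewrite -scalerAl -scalerAr scalerA s2 scaler_nat mulr_natl. Qed.

Lemma rescaled_BB : lcomm B B' = 0.
Proof. by rewrite BE B'E /lcomm !mulZZ -mulrBr (BB_relation rel) mulr0. Qed.

Lemma rescaled_CC : lcomm C C' = 0.
Proof. by rewrite CE C'E /lcomm !mulZZ -mulrBr (CC_relation rel) mulr0. Qed.

Lemma rescaled_AB : dl * lcomm a B' = p * (c *: (B * b - B' * a)).
Proof.
rewrite BE B'E /lcomm -!scalerAl -scalerAr -!scalerBr.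
exact: scale_rel (AB_relation rel).
Qed.

Lemma rescaled_AC : dl * lcomm a C' = p * (c *: (a * C' - b * C)).
Proof.
have -> : lcomm a C' = s *: (a * (f' * b) - f' * b * a).
  by rewrite C'E /lcomm -scalerAl -scalerAr -scalerBr.
have -> : a * C' - b * C = s *: (a * (f' * b) - b * (f * a)).
  by rewrite CE C'E -!scalerAr -scalerBr.
exact: scale_rel (AC_relation rel).
Qed.

Lemma rescaled_BC : dl * lcomm B C' = p * (c *: (a * D' - b * D)).
Proof.
rewrite BE C'E /lcomm !mulZZ -mulrBr (BC_relation rel) DE D'E.
by rewrite -scalerAl scalerAr.
Qed.

Lemma rescaled_BD : dl * lcomm B D' = p * (c *: (B * D' - B' * D)).
Proof.
rewrite BE B'E /lcomm -!scalerAl -scalerAr -!scalerBr DE D'E.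
exact: scale_rel (BD_relation rel).
Qed.

Lemma rescaled_CD : dl * lcomm C D' = p * (c *: (D * C' - D' * C)).
Proof.
have -> : lcomm C D' = s *: (f * a * D' - D' * (f * a)).
  by rewrite CE /lcomm -scalerAl -scalerAr -scalerBr.
have -> : D * C' - D' * C = s *: (D * (f' * b) - D' * (f * a)).
  by rewrite CE C'E -!scalerAr -scalerBr.
by rewrite DE D'E; exact: scale_rel (CD_relation rel).
Qed.

Lemma rescaled_AD : dl * lcomm a D' = p * (c *: (B * C' - B' * C)).
Proof.
rewrite BE B'E CE C'E !mulZZ -mulrBr D'E /lcomm (AD_relation rel).
by rewrite -scalerAl scalerAr.
Qed.

End RescaledRelations.

Section RescaledSeries.
Variables (K : nzRingType) (S : algType K) (a h e f : fps S) (s : K) (n : nat).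

Lemma in_u_rescaledM : in_u (s *: (a * e)) = s *: (in_u a * in_u e).
Proof. by rewrite in_uZ in_uM. Qed.

Lemma in_v_rescaledM : in_v (s *: (a * e)) = s *: (in_v a * in_v e).
Proof. by rewrite in_vZ in_vM. Qed.

Hypothesis s2 : s * s = n%:R.
Hypothesis a0 : a 0 = 1.

(** [D] is defined by a Gauss decomposition of the matrix with rows [A, B] and [C, D]; its [A^-1]
    cancels against the [A] at the left of [B]. *)
Lemma rescaled_gauss : a * h + s *: (f * a) * fps_inv a * (s *: (a * e))
  = a * h + n%:R *: (f * a * e).
Proof.
rewrite -!scalerAl -scalerAr scalerA s2 -!mulrA.
by rewrite [fps_inv a * _]mulrA fps_mulVr // mul1r.
Qed.

Lemma in_u_gauss : in_u (a * h + s *: (f * a) * fps_inv a * (s *: (a * e)))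
  = in_u a * in_u h + n%:R * (in_u f * in_u a * in_u e).
Proof. by rewrite rescaled_gauss in_uD in_uZ !in_uM scaler_nat mulr_natl. Qed.

Lemma in_v_gauss : in_v (a * h + s *: (f * a) * fps_inv a * (s *: (a * e)))
  = in_v a * in_v h + n%:R * (in_v f * in_v a * in_v e).
Proof. by rewrite rescaled_gauss in_vD in_vZ !in_vM scaler_nat mulr_natl. Qed.

End RescaledSeries.

Section SeriesRelations.
Variables (K : comNzRingType) (S : algType K) (a h e f : fps S) (c q s : K) (n : nat).
Variables (eps phi eta : fps (fps S)).
Local Notation x := (fps_uinv S).
Hypothesis rel : current_relations (in_v x - in_u x) (c *: (in_u x * in_v x))
  (q *: (in_u x * in_v x)) n%:R
  (in_u a) (in_v a) (in_u h) (in_v h) (in_u e) (in_v e) (in_u f) (in_v f)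
  eps phi eta.
Hypothesis s2 : s * s = n%:R.
Hypothesis a0 : a 0 = 1.

Local Notation B := (s *: (a * e)).
Local Notation C := (s *: (f * a)).
Local Notation D := (a * h + C * fps_inv a * B).

Let Bu := in_u_rescaledM a e s.
Let Bv := in_v_rescaledM a e s.
Let Cu := in_u_rescaledM f a s.
Let Cv := in_v_rescaledM f a s.
Let Du := in_u_gauss h e f s2 a0.
Let Dv := in_v_gauss h e f s2 a0.

Lemma lcomm_BB : lcomm (in_u B) (in_v B) = 0.
Proof. exact (rescaled_BB rel s2 Bu Bv). Qed.

Lemma lcomm_CC : lcomm (in_u C) (in_v C) = 0.
Proof. exact (rescaled_CC rel s2 Cu Cv). Qed.

Lemma umv_AB : umv_mul_eq (lcomm (in_u a) (in_v B))
  (c *: (in_u B * in_v a - in_v B * in_u a)).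
Proof. exact (rescaled_AB rel Bu Bv). Qed.

Lemma umv_AC : umv_mul_eq (lcomm (in_u a) (in_v C))
  (c *: (in_u a * in_v C - in_v a * in_u C)).
Proof. exact (rescaled_AC rel Cu Cv). Qed.

Lemma umv_BC : umv_mul_eq (lcomm (in_u B) (in_v C))
  (c *: (in_u a * in_v D - in_v a * in_u D)).
Proof. exact (rescaled_BC rel s2 Bu Cv Du Dv). Qed.

Lemma umv_BD : umv_mul_eq (lcomm (in_u B) (in_v D))
  (c *: (in_u B * in_v D - in_v B * in_u D)).
Proof. exact (rescaled_BD rel Bu Bv Du Dv). Qed.

Lemma umv_CD : umv_mul_eq (lcomm (in_u C) (in_v D))
  (c *: (in_u D * in_v C - in_v D * in_u C)).
Proof. exact (rescaled_CD rel Cu Cv Du Dv). Qed.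

Lemma umv_AD : umv_mul_eq (lcomm (in_u a) (in_v D))
  (c *: (in_u B * in_v C - in_v B * in_u C)).
Proof. exact (rescaled_AD rel s2 Bu Bv Cu Cv Dv). Qed.

End SeriesRelations.

Lemma lcommM_eq0 (S : nzRingType) (x y z w : S) :
  GRing.comm x z -> GRing.comm x w -> GRing.comm y z -> GRing.comm y w ->
  lcomm (x * y) (z * w) = 0.
Proof.
have commMl k : GRing.comm x k -> GRing.comm y k -> GRing.comm (x * y) k.
  by move=> xk yk; apply/commr_sym/commrM; exact: commr_sym.
move=> xz xw yz yw; rewrite /lcomm (_ : _ * _ = z * w * (x * y)) ?subrr //.
by apply: commrM; exact: commMl.
Qed.

Section CommutingSeries.
Variables (K : comNzRingType) (S : algType K).
Implicit Types (f g : fps S) (s t : K).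

Let lcommZ_eq0 s (T : algType K) (y z : T) : lcomm y z = 0 -> lcomm y (s *: z) = 0.
Proof.
move=> yz; rewrite /lcomm -scalerAl -scalerAr -scalerBr.
by rewrite -/(lcomm y z) yz scaler0.
Qed.

Let lcommZZ_eq0 s t (T : algType K) (y z : T) :
  lcomm y z = 0 -> lcomm (s *: y) (t *: z) = 0.
Proof.
move=> yz; rewrite /lcomm -!scalerAl -!scalerAr !scalerA mulrC -scalerBr.
by rewrite -/(lcomm y z) yz scaler0.
Qed.

Lemma lcomm_uv_rescaled f g1 g2 t :
  in_u f * in_v g1 = in_v g1 * in_u f -> in_u f * in_v g2 = in_v g2 * in_u f ->
  lcomm (in_u f) (in_v (t *: (g1 * g2))) = 0.
Proof.
move=> fg1 fg2; rewrite in_v_rescaledM; apply: lcommZ_eq0.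
exact/lcomm_eq0/commrM.
Qed.

Lemma lcomm_uv_rescaled2 f1 f2 g1 g2 s t :
  in_u f1 * in_v g1 = in_v g1 * in_u f1 -> in_u f1 * in_v g2 = in_v g2 * in_u f1 ->
  in_u f2 * in_v g1 = in_v g1 * in_u f2 -> in_u f2 * in_v g2 = in_v g2 * in_u f2 ->
  lcomm (in_u (s *: (f1 * f2))) (in_v (t *: (g1 * g2))) = 0.
Proof.
move=> *; rewrite in_u_rescaledM in_v_rescaledM; apply: lcommZZ_eq0.
exact: lcommM_eq0.
Qed.

End CommutingSeries.

Theorem proposition2p1 (R : realType)
  (g : vectType R[i]) (br : lie_bracket g) (g_simple : lie_simple br)
  (h : {vspace g}) (h_cartan : cartan_subalgebra br h)
  (l : nat) (alpha : 'I_l -> dual h) (alpha_simple : simple_roots br alpha)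
  (alphav : 'I_l -> subvs_of h)
  (alphav_coroot : forall i, is_coroot br (alpha i) (alphav i))
  (a : 'M[int]_l) (aE : forall i j, (a i j)%:~R = alpha j (alphav i) :> R[i])
  (d : 'I_l -> nat) (d_gt0 : forall i, (0 < d i)%N)
  (d_sym : forall i j, (d i)%:Z * a i j = (d j)%:Z * a j i)
  (hbar : R[i]) (hbar_neq0 : hbar != 0)
  (Y : algType R[i]) (H E F : 'I_l -> nat -> Y)
  (Y_yangian : is_yangian a d hbar H E F)
  (A_ : 'I_l -> nat -> Y) (A_coefs : coefs_in_H_subalgebra H A_)
  (A_fact : H_factorisation a d hbar H A_) :
  let A := Aser A_ in let B := Bser d E A_ in
  let C := Cser d F A_ in let D := Dser d H E F A_ in
  let ihd i : R[i] := 'i * hbar * (d i)%:R in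
  (forall i j, lcomm (in_u (A i)) (in_v (A j)) = 0) /\
  (forall i j, i != j ->
    lcomm (in_u (A i)) (in_v (B j)) = 0 /\
    lcomm (in_u (A i)) (in_v (C j)) = 0) /\
  (forall i j, a i j = 0 -> i != j ->
    lcomm (in_u (B i)) (in_v (B j)) = 0 /\
    lcomm (in_u (C i)) (in_v (C j)) = 0) /\
  (forall i,
    lcomm (in_u (B i)) (in_v (B i)) = 0 /\
    lcomm (in_u (C i)) (in_v (C i)) = 0) /\
  (forall i j, i != j -> lcomm (in_u (B i)) (in_v (C j)) = 0) /\
  (forall i, umv_mul_eq (lcomm (in_u (A i)) (in_v (B i)))
    (ihd i *: (in_u (B i) * in_v (A i) - in_v (B i) * in_u (A i)))) /\
  (forall i, umv_mul_eq (lcomm (in_u (A i)) (in_v (C i)))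
    (ihd i *: (in_u (A i) * in_v (C i) - in_v (A i) * in_u (C i)))) /\
  (forall i, umv_mul_eq (lcomm (in_u (B i)) (in_v (C i)))
    (ihd i *: (in_u (A i) * in_v (D i) - in_v (A i) * in_u (D i)))) /\
  (forall i, umv_mul_eq (lcomm (in_u (B i)) (in_v (D i)))
    (ihd i *: (in_u (B i) * in_v (D i) - in_v (B i) * in_u (D i)))) /\
  (forall i, umv_mul_eq (lcomm (in_u (C i)) (in_v (D i)))
    (ihd i *: (in_u (D i) * in_v (C i) - in_v (D i) * in_u (C i)))) /\
  (forall i, umv_mul_eq (lcomm (in_u (A i)) (in_v (D i)))
    (ihd i *: (in_u (B i) * in_v (C i) - in_v (B i) * in_u (C i)))).
Proof.
move=> A B C D ihd.
have [h_toral _] := h_cartan; have [Y_rel _] := Y_yangian.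
have a_ker :=
  @cartan_matrix_ker _ _ _ _ h_toral _ _ alpha_simple _ alphav_coroot _ aE Y.
have a_diag := cartan_matrix_diag alphav_coroot aE.
have a_off := cartan_matrix_off_le0 h_toral alpha_simple alphav_coroot aE.
have s2 i : sqrtC (d i)%:R * sqrtC (d i)%:R = (d i)%:R :> R[i].
  by rewrite -expr2 sqrtCK.
have A0 i : gen1 (A_ i) 0 = 1 by exact: gen1_0.
have ihdE i : ihd i = kap a d hbar i i by rewrite kap_diag.
have rel := yangian_current_relations a_ker a_diag a_off d_sym Y_rel A_coefs A_fact.
have AA i j : in_u (A i) * in_v (A j) = in_v (A j) * in_u (A i).
  by apply/in_uv_comm/(AA_coef_comm Y_rel A_coefs).
have AEcc := AE_coef_comm a_ker a_diag a_off d_sym Y_rel A_coefs A_fact.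
have AFcc := AF_coef_comm a_ker a_diag a_off d_sym Y_rel A_coefs A_fact.
have AE i j : i != j ->
    in_u (A i) * in_v (gen0 (E j)) = in_v (gen0 (E j)) * in_u (A i).
  by move=> ij; apply/in_uv_comm/AEcc.
have AF i j : i != j ->
    in_u (A i) * in_v (gen0 (F j)) = in_v (gen0 (F j)) * in_u (A i).
  by move=> ij; apply/in_uv_comm/AFcc.
(* Commutation holds for each pair of coefficients, so it does not matter which of the two series
   carries [u]. *)
have EA i j : i != j ->
    in_u (gen0 (E i)) * in_v (A j) = in_v (A j) * in_u (gen0 (E i)).
  by move=> ij; apply/in_uv_comm/coef_comm_sym/AEcc; rewrite eq_sym.
have FA i j : i != j ->
    in_u (gen0 (F i)) * in_v (A j) = in_v (A j) * in_u (gen0 (F i)).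
  by move=> ij; apply/in_uv_comm/coef_comm_sym/AFcc; rewrite eq_sym.
have EE i j : a i j = 0 -> i != j ->
    in_u (gen0 (E i)) * in_v (gen0 (E j)) = in_v (gen0 (E j)) * in_u (gen0 (E i)).
  by move=> aij ij; apply/in_uv_comm/(EE_coef_comm Y_rel).
have FF i j : a i j = 0 -> i != j ->
    in_u (gen0 (F i)) * in_v (gen0 (F j)) = in_v (gen0 (F j)) * in_u (gen0 (F i)).
  by move=> aij ij; apply/in_uv_comm/(FF_coef_comm Y_rel).
have EF := EF_comm Y_rel.
split; first by move=> i j; apply/lcomm_eq0/AA.
split=> [i j ij|].
  by split; apply: lcomm_uv_rescaled; [exact: AA | exact: AE | exact: AF | exact: AA].
split=> [i j aij ij|].
  split; apply: lcomm_uv_rescaled2;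
    [exact: AA | exact: AE | exact: EA | exact: EE
    |exact: FF | exact: FA | exact: AF | exact: AA].
split=> [i|].
  by split; [exact (lcomm_BB (rel i) (s2 i)) | exact (lcomm_CC (rel i) (s2 i))].
split=> [i j ij|].
  by apply: lcomm_uv_rescaled2; [exact: AF | exact: AA | exact: EF | exact: EA].
split=> [i|]; first by rewrite ihdE; exact (umv_AB _ (rel i)).
split=> [i|]; first by rewrite ihdE; exact (umv_AC _ (rel i)).
split=> [i|]; first by rewrite ihdE; exact (umv_BC (rel i) (s2 i) (A0 i)).
split=> [i|]; first by rewrite ihdE; exact (umv_BD (rel i) (s2 i) (A0 i)).
split=> [i|]; first by rewrite ihdE; exact (umv_CD (rel i) (s2 i) (A0 i)).
by move=> i; rewrite ihdE; exact (umv_AD (rel i) (s2 i) (A0 i)).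
Qed.
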